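(* Let $f$ be a bounded function on $\mathbb{R}^m$. The origin is a critical point of Poisson's integral $Pf(\cdot,h):\mathbb{R}^m\to\mathbb{R}$ for any $h>0$ if and only if $f$ satisfies the balance law at the origin, that is, $$\int_{rS^{m-1}} f(v)\,v\,d\sigma(v)=0$$ for any $r\ge 0$.
   Context: $rS^{m-1}$ is the sphere of radius $r$ centered at the origin of $\mathbb{R}^m$, $\sigma$ denotes $(m-1)$-dimensional surface measure, and $\sigma_m(S^m)$ is the surface area of the unit sphere $S^m\subset\mathbb{R}^{m+1}$. Poisson's integral of a bounded function $f:\mathbb{R}^m\to\mathbb{R}$ is $$Pf(x,h)=\int_{\mathbb{R}^m}p(x-y,h)f(y)\,dy,\qquad x\in\mathbb{R}^m,\ h>0,$$ where $p(z,h)=\dfrac{2}{\sigma_m(S^m)}\dfrac{h}{(|z|^2+h^2)^{(m+1)/2}}$ is Poisson's kernel. A critical point of $Pf(\cdot,h)$ is a point where its gradient with respect to $x$ vanishes.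
   Formalization: f is taken Lebesgue measurable; for such bounded f the balance law is claimed only for almost every r ≥ 0 (for every r it fails, e.g. f the indicator of an open half of the unit sphere), and for every r ≥ 0 when f is also continuous. *)

(* Defs.v *)
From HB Require Import structures.
From mathcomp Require Import all_boot all_order all_algebra.
From mathcomp Require Import all_classical all_reals all_analysis.
From mathcomp Require Import measurable_realfun.

Set Implicit Arguments.
Unset Strict Implicit.
Unset Printing Implicit Defensive.

Import Order.TTheory GRing.Theory Num.Theory.
Import numFieldNormedType.Exports.

Local Open Scope classical_set_scope.
Local Open Scope ring_scope.

Definition rV_display : measure_display -> measure_display.
Proof. exact. Qed.

(* Same construction as the library's sigma-algebra on n.-tuple T: the product
   sigma-algebra, which on 'rV[R]_m is the Borel one. *)
Section measurable_rV.
Context (R : realType) (m : nat).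

Let coors : 'I_m -> 'rV[R]_m -> R := fun i x => x ord0 i.

Let rV_set0 : g_sigma_preimage coors set0.
Proof. exact: sigma_algebra0. Qed.

Let rV_setC A : g_sigma_preimage coors A -> g_sigma_preimage coors (~` A).
Proof. exact: sigma_algebraC. Qed.

Let rV_bigcup (F : _^nat) : (forall i, g_sigma_preimage coors (F i)) ->
  g_sigma_preimage coors (\bigcup_i (F i)).
Proof. exact: sigma_algebra_bigcup. Qed.

HB.instance Definition _ :=
  @isMeasurable.Build (rV_display default_measure_display)
  ('rV[R]_m) (g_sigma_preimage coors) rV_set0 rV_setC rV_bigcup.

End measurable_rV.

Section measurable_rV_theory.
Context (R : realType).

Lemma measurable_coord m (i : 'I_m) :
  measurable_fun [set: 'rV[R]_m] (fun x : 'rV[R]_m => x ord0 i).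
Proof.
move=> _ Y mY; rewrite setTI; apply: sub_sigma_algebra => /=.
rewrite -bigcup_seq/=; exists i => /=; first by rewrite mem_index_enum.
by exists Y => //; rewrite setTI.
Qed.

Lemma measurable_fun_rV d (T : measurableType d) m (f : T -> 'rV[R]_m) :
  (forall i, measurable_fun [set: T] (fun t => f t ord0 i)) ->
  measurable_fun [set: T] f.
Proof.
move=> mf _ A mA; rewrite setTI.
pose G := image_set_system [set: T] f measurable.
suff : G A by rewrite /G /image_set_system/= setTI.
move: A mA; apply: smallest_sub.
  by apply: sigma_algebra_image; exact: sigma_algebra_measurable.
move=> A; rewrite -bigcup_seq/= => -[i _ [B mB <-]].
by rewrite /G /image_set_system/= !setTI -[X in measurable X]setTI; exact: mf.
Qed.

End measurable_rV_theory.

Section lebesgue_measure_rV.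
Context (R : realType).

Definition cons_rV m (p : measurableTypeR R * 'rV[R]_m) : 'rV[R]_m.+1 :=
  \row_i oapp (p.2 ord0) p.1 (unlift ord0 i).

Lemma cons_rV0 m p : @cons_rV m p ord0 ord0 = p.1.
Proof. by rewrite mxE unlift_none. Qed.

Lemma cons_rVS m p (i : 'I_m) : @cons_rV m p ord0 (lift ord0 i) = p.2 ord0 i.
Proof. by rewrite mxE liftK. Qed.

Lemma measurable_cons_rV m : measurable_fun setT (@cons_rV m).
Proof.
apply: measurable_fun_rV => i; have [j ->|->] := unliftP ord0 i.
  under eq_fun do rewrite cons_rVS.
  exact: (measurableT_comp (measurable_coord j) measurable_snd).
by under eq_fun do rewrite cons_rV0; exact: measurable_fst.
Qed.

Definition uncons_rV m (x : 'rV[R]_m.+1) : measurableTypeR R * 'rV[R]_m :=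
  (x ord0 ord0, \row_i x ord0 (lift ord0 i)).

Lemma measurable_uncons_rV m : measurable_fun setT (@uncons_rV m).
Proof.
apply: measurable_fun_pair; first exact: measurable_coord.
apply: measurable_fun_rV => i; under eq_fun do rewrite mxE.
exact: measurable_coord.
Qed.

Lemma cons_rVK m : cancel (@cons_rV m) (@uncons_rV m).
Proof.
move=> [a y]; rewrite /uncons_rV cons_rV0; congr pair.
by apply/rowP => i; rewrite mxE cons_rVS.
Qed.

Lemma uncons_rVK m : cancel (@uncons_rV m) (@cons_rV m).
Proof.
move=> x; apply/rowP => i; have [j ->|->] := unliftP ord0 i.
  by rewrite cons_rVS /= mxE.
by rewrite cons_rV0.
Qed.

Section succ.
Context (m : nat) (mu : {sigma_finite_measure set 'rV[R]_m -> \bar R}).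

Definition lebesgue_rVS : set 'rV[R]_m.+1 -> \bar R :=
  pushforward (lebesgue_measure \x mu)%E (@cons_rV m).

HB.instance Definition _ := Measure.copy lebesgue_rVS
  (measure_function_pushforward__canonical__measure_function_Measure
     (lebesgue_measure \x mu)%E (@measurable_cons_rV m)).

Let sigma_finite_lebesgue_rVS : sigma_finite setT lebesgue_rVS.
Proof.
have /sigma_finiteP[F [UF ndF Foo]] := sigma_finiteT (@lebesgue_measure R).
have /sigma_finiteP[G [UG ndG Goo]] := sigma_finiteT mu.
exists (fun n => @uncons_rV m @^-1` (F n `*` G n)).
  apply/seteqP; split => // x _.
  have [k _ Fk] : (\bigcup_k F k) (uncons_rV x).1 by rewrite -UF.
  have [l _ Gl] : (\bigcup_k G k) (uncons_rV x).2 by rewrite -UG.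
  exists (maxn k l) => //; split.
  - by move: Fk; exact/subsetPset/ndF/leq_maxl.
  - by move: Gl; exact/subsetPset/ndG/leq_maxr.
move=> n; have [mF Fn] := Foo n; have [mG Gn] := Goo n; split.
  rewrite -[X in measurable X]setTI; apply: measurable_uncons_rV => //.
  exact: measurableX.
rewrite /lebesgue_rVS /pushforward -comp_preimage.
rewrite (_ : _ \o _ = id) ?preimage_id; last exact/funext/cons_rVK.
by rewrite product_measure1E// lte_mul_pinfty// ge0_fin_numE.
Qed.
HB.instance Definition _ := Measure_isSigmaFinite.Build _ _ _ lebesgue_rVS
  sigma_finite_lebesgue_rVS.

End succ.

Fixpoint lebesgue_rV m : {sigma_finite_measure set 'rV[R]_m -> \bar R} :=
  match m with
  | 0%N => \d_(0 : 'rV[R]_0)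
  | m'.+1 => lebesgue_rVS (lebesgue_rV m')
  end.
End lebesgue_measure_rV.
Arguments lebesgue_rV : clear implicits.

Section euclidean.
Context (R : realType) (m : nat).
Implicit Types (x : 'rV[R]_m) (r : R).

(* The library's norm on 'rV[R]_m is the sup norm. *)
Definition enorm x : R := Num.sqrt (\sum_(i < m) x ord0 i ^+ 2).

Definition sphere r : set 'rV[R]_m := [set x | enorm x = r].

Definition unit_ball : set 'rV[R]_m := [set x | enorm x <= 1].

Definition sphere_proj r x : 'rV[R]_m := (r / enorm x) *: x.

Lemma measurable_enorm : measurable_fun [set: 'rV[R]_m] enorm.
Proof.
apply: (@measurableT_comp _ _ _ _ _ _ (@Num.sqrt R)).
  by apply: continuous_measurable_fun; exact: sqrt_continuous.
by apply: measurable_sum => i; apply: measurable_funX; exact: measurable_coord.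
Qed.

Lemma measurable_unit_ball : measurable unit_ball.
Proof.
rewrite (_ : unit_ball = enorm @^-1` `]-oo, 1]%classic).
  by rewrite -[X in measurable X]setTI; exact: measurable_enorm.
by apply/seteqP; split => x /=; rewrite in_itv.
Qed.

Lemma measurable_sphere_proj r : measurable_fun setT (sphere_proj r).
Proof.
apply: measurable_fun_rV => i; under eq_fun do rewrite mxE.
apply: measurable_funM; last exact: measurable_coord.
apply: measurable_funM => //.
under eq_fun do rewrite -powR_inv1 ?sqrtr_ge0//.
exact: (measurableT_comp (measurable_powR (-1)) measurable_enorm).
Qed.

Definition radial_image r : set 'rV[R]_m -> \bar R :=
  pushforward (mrestr (lebesgue_rV R m) measurable_unit_ball) (sphere_proj r).

HB.instance Definition _ r := Measure.copy (radial_image r)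
  (measure_function_pushforward__canonical__measure_function_Measure
     (mrestr (lebesgue_rV R m) measurable_unit_ball)
     (measurable_sphere_proj r)).

(* Surface measure on the sphere of radius r >= 0, as a measure on R^m carried
   by that sphere: sigma(A) = m r^(m-1) |{x in the unit ball : r x/|x| in A}|.
   For r = 1 and A in the unit sphere this is the cone formula
   m |{t a : a in A, 0 < t <= 1}|; for other radii it is scaled by r^(m-1).
   The absolute value only serves to make the factor nonnegative. *)
Definition surface_measure r : set 'rV[R]_m -> \bar R :=
  mscale (m%:R * `|r| ^+ m.-1)%:nng (radial_image r).

HB.instance Definition _ r := Measure.on (surface_measure r).

Definition lebesgue_measurable_fun (f : 'rV[R]_m -> R) : Prop :=
  exists2 g : 'rV[R]_m -> R, measurable_fun setT g &
    {ae lebesgue_rV R m, forall x, f x = g x}.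

Definition gradient (u : 'rV[R]_m -> R) x : 'rV[R]_m :=
  \row_(i < m) 'D_(delta_mx ord0 i) u x.

Definition critical_point (u : 'rV[R]_m -> R) x : Prop :=
  differentiable u x /\ gradient u x = 0.

End euclidean.
Arguments sphere {R} m r.
Arguments surface_measure {R} m r.

Section poisson.
Context (R : realType) (m : nat).
Implicit Types (f : 'rV[R]_m -> R) (x z : 'rV[R]_m) (h r : R).

(* Area of the unit sphere S^m of R^(m+1). *)
Definition sphere_area : R :=
  fine (surface_measure m.+1 1 (sphere m.+1 (1 : R))).

Definition poisson_kernel z h : R :=
  2 / sphere_area * (h / (enorm z ^+ 2 + h ^+ 2) `^ (m.+1%:R / 2)).

Definition poisson_integral f x h : R :=
  \int[lebesgue_rV R m]_y (poisson_kernel (x - y) h * f y).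

Definition balance_law f r : Prop :=
  \row_(i < m) \int[surface_measure m r]_(v in sphere m r) (f v * v ord0 i)
    = 0 :> 'rV[R]_m.

End poisson.

(* Main.v *)
Require Import Defs.
From HB Require Import structures.
From mathcomp Require Import all_boot all_order all_algebra.
From mathcomp Require Import all_classical all_reals all_analysis.
From mathcomp Require Import measurable_realfun ring lra.

Import Order.TTheory GRing.Theory Num.Theory.
Import numFieldNormedType.Exports.

(* Differentiating Poisson's kernel, the i-th partial derivative of Pf(., h) at
   0 is a positive multiple of the integral of f(y) y_i (|y|^2 + h^2)^(-(m+3)/2)
   over R^m, that is, in polar coordinates, of the integral of
   F_i(r) (r^2 + h^2)^(-(m+3)/2) over r > 0, where F_i(r) is the integral of
   f(v) v_i over the sphere of radius r. If F_i = 0 a.e. this vanishes.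
   Conversely, if it vanishes for all h, then differentiating in h^2 shows that
   F_i integrates to 0 against (1 + r^2)^(-(m+3)/2) p(1/(1 + r^2)) for every
   polynomial p. The polynomials (1 - u^n)^[c^n] tend to the indicator function
   of u < 1/c, so F_i(r) (1 + r^2)^(-(m+3)/2) integrates to 0 over every
   half-line, hence F_i = 0 a.e. When f is continuous so is F_i, and then
   F_i = 0 everywhere. *)

(** Poisson's integral sees [f] only up to a null set, and a null set may contain whole spheres. So
    [f] is replaced by a bounded Borel function [g] equal to it off a Borel null set [N]; polar
    coordinates show that almost every sphere meets [N] in a set of zero surface measure, and on
    such spheres [f] and [g] have the same balance integrals. All differentiation, in h^2 as in x,
    goes through the second-order bound [powRN_taylor] integrated against the data: the remainder is
    dominated by an integrable kernel of larger exponent, and in x this yields a Frechet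
    differential at once, not only partial derivatives. The step polynomials suit the converse
    because they stay in [0, 1] for u in [0, 1], so that the kernel itself is a dominating function,
    and because their limits follow from Bernoulli-type inequalities alone. *)

Local Open Scope classical_set_scope.
Local Open Scope ring_scope.

(** * Expansion of negative powers and step polynomials *)

Section powR_expansion.
Context {R : realType}.
Implicit Types a b s u d : R.

(** Write s^(-b) as exp(- b ln s) and use exp x >= 1 + x, then ln s <= s - 1. *)
Lemma powRN_ge_tangent b s : 0 <= b -> 0 < s -> 1 - b * (s - 1) <= s `^ (- b).
Proof.
move=> b0 s0; rewrite /powR gt_eqF//.
apply: le_trans (expR_ge1Dx _); rewrite lerD2l mulNr lerN2 ler_wpM2l//.
by rewrite -[in leLHS](subrKC 1 s) le_ln1Dx// ltrBDl addrN.
Qed.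

(** This is the preceding bound at 1/s, multiplied by s^(-b). *)
Lemma powRN_le_tangent b s : 0 <= b -> 0 < s ->
  s `^ (- b) - 1 <= b * s `^ (- b - 1) * (1 - s).
Proof.
move=> b0 s0; have /(powRN_ge_tangent _ _ b0) : 0 < s^-1 by rewrite invr_gt0.
rewrite -(powR_inv1 (ltW s0)) -powRrM mulN1r opprK => h.
have p0 : 0 < s `^ (- b) by exact: powR_gt0.
have := ler_wpM2r (ltW p0) h.
have sn0 : s != 0 by rewrite gt_eqF.
rewrite -powRD ?sn0 ?implybT// subrr powRr0.
rewrite powRD ?sn0 ?implybT//.
set q := s `^ (-1); set p := s `^ (- b) => h1.
have qs : q * s = 1 by rewrite /q (powR_inv1 (ltW s0)) mulVf.
have -> : b * (p * q) * (1 - s) = b * p * (q - q * s) by ring.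
rewrite qs; lra.
Qed.

(** For s >= 1 the lower tangent suffices; for s < 1 the upper one does, and 2^(b+1) is the largest
    value of s^(-b-1) on s >= 1/2. *)
Lemma powRN_dist1 b s : 0 <= b -> 2^-1 <= s ->
  `|s `^ (- b) - 1| <= b * 2 `^ (b + 1) * `|s - 1|.
Proof.
move=> b0 hs; have s0 : 0 < s by lra.
have h1 := powRN_ge_tangent _ _ b0 s0; have h2 := powRN_le_tangent _ _ b0 s0.
have two1 : 1 <= 2 `^ (b + 1) :> R by rewrite -{1}(powRr0 2) ler_powR//; lra.
have [s1|s1] := leP 1 s.
  rewrite (ger0_norm (_ : 0 <= s - 1)) ?subr_ge0// ler0_norm; last first.
    apply: le_trans h2 _.
    by rewrite mulr_ge0_le0 ?mulr_ge0 ?powR_ge0// subr_le0.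
  have : b * (s - 1) * 1 <= b * (s - 1) * 2 `^ (b + 1).
    by rewrite ler_wpM2l// mulr_ge0// subr_ge0.
  lra.
rewrite (ltr0_norm (_ : s - 1 < 0)) ?subr_lt0// ger0_norm; last first.
  have : 0 <= b * (1 - s) by rewrite mulr_ge0// subr_ge0 ltW.
  lra.
rewrite opprB; apply: (le_trans h2).
rewrite ler_wpM2r ?subr_ge0 ?(ltW s1)// ler_wpM2l//.
rewrite -opprD powRN -powR_inv1 ?powR_ge0// -powRrM mulrC powRrM.
rewrite (powR_inv1 (ltW s0)).
apply: ge0_ler_powR; rewrite ?nnegrE//; try lra.
by rewrite invr_ge0 ltW.
by rewrite -[leRHS]invrK lef_pV2// ?posrE// invr_gt0.
Qed.

(** The lower tangent makes the remainder nonnegative; the upper one bounds it by a (s^(-a-1) - 1)(1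
    - s), to which [powRN_dist1] with b = a + 1 supplies the second factor s - 1. No second
    derivative is taken. *)
Lemma powRN_taylor1 a s : 0 <= a -> 2^-1 <= s ->
  `|s `^ (- a) - 1 + a * (s - 1)| <= a * ((a + 1) * 2 `^ (a + 2)) * (s - 1) ^+ 2.
Proof.
move=> a0 hs; have s0 : 0 < s by lra.
have h1 := powRN_ge_tangent _ _ a0 s0; have h2 := powRN_le_tangent _ _ a0 s0.
rewrite ger0_norm; last by lra.
have a1 : 0 <= a + 1 by lra.
have := powRN_dist1 _ _ a1 hs; rewrite -addrA => h3.
have {}h3 : (s `^ (- (a + 1)) - 1) * (1 - s) <=
    (a + 1) * 2 `^ (a + (1 + 1)) * `|s - 1| * `|1 - s|.
  by rewrite (le_trans (ler_norm _))// normrM ler_wpM2r.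
rewrite (distrC 1) -mulrA -expr2 real_normK ?num_real// in h3.
have := ler_wpM2l a0 h3; rewrite opprD; set K := (X in _ <= X -> _).
rewrite -mulrA -[leRHS]/K -[s `^ (-a - 1)]/(s `^ (-a - 1)) => h4.
by apply: le_trans h4; move: h2; set p := s `^ (-a-1); lra.
Qed.

(** By homogeneity this is [powRN_taylor1] at s = 1 + d/u, and the bound on d gives s >= 1/2. It
    serves twice: with d an increment of h^2, and with d the change of |y|^2 when y is shifted by
    x. *)
Lemma powRN_taylor a u d : 0 <= a -> 0 < u -> `|d| <= u / 2 ->
  `|(u + d) `^ (- a) - u `^ (- a) + a * d * u `^ (- a - 1)| <=
  a * ((a + 1) * 2 `^ (a + 2)) * (d ^+ 2 * u `^ (- a - 2)).
Proof.
move=> a0 u0 hd.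
have un0 : u != 0 by rewrite gt_eqF.
have hs : 2^-1 <= 1 + d / u.
  have : `|d / u| <= 2^-1 by rewrite normrM normfV (gtr0_norm u0) ler_pdivrMr// mulrC.
  rewrite ler_norml; lra.
have -> : u + d = u * (1 + d / u) by field.
rewrite powRM ?(ltW u0)//; last by lra.
have -> : u `^ (- a - 1) = u `^ (- a) * u^-1.
  by rewrite powRD ?un0 ?implybT// (powR_inv1 (ltW u0)).
have -> : u `^ (- a - 2) = u `^ (- a) * u^-1 ^+ 2.
  by rewrite powRD ?un0 ?implybT// -[2]/(2%:R) (powR_invn _ (ltW u0)) exprVn.
have := powRN_taylor1 _ _ a0 hs.
rewrite (addrC 1) addrK; set p := u `^ (- a); set q := _ `^ (- a).
have p0 : 0 < p by apply: powR_gt0.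
move=> /(ler_wpM2l (ltW p0)); rewrite -{1}(gtr0_norm p0) -normrM.
rewrite [X in `|X| <= _ -> _](_ : _ = p * q - p + a * d * (p / u)); last by ring.
by move/le_trans; apply; rewrite exprMn le_eqVlt; apply/orP; left; apply/eqP; ring.
Qed.

End powR_expansion.

Section step_polynomials.
Context {R : realType}.
Implicit Types c u : R.

(** These are the functions of the Brosowski-Deutsch proof of the Stone-Weierstrass theorem, with an
    integer part so that c can be any real. *)
Definition step_poly c n : {poly R} := (1 - 'X^n) ^+ Num.truncn (c ^+ n).

Lemma horner_step_poly c n u :
  (step_poly c n).[u] = (1 - u ^+ n) ^+ Num.truncn (c ^+ n).
Proof. by rewrite /step_poly !hornerE. Qed.

Lemma step_poly_ge0 c n u : 0 <= u <= 1 -> 0 <= (step_poly c n).[u].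
Proof.
by move=> /andP[u0 u1]; rewrite horner_step_poly exprn_ge0// subr_ge0 exprn_ile1.
Qed.

Lemma step_poly_le1 c n u : 0 <= u <= 1 -> (step_poly c n).[u] <= 1.
Proof.
move=> /andP[u0 u1]; rewrite horner_step_poly exprn_ile1//.
  by rewrite subr_ge0 exprn_ile1.
by rewrite lerBlDr lerDl exprn_ge0.
Qed.

Lemma bernoulli_ge (x : R) N : 0 <= x <= 1 -> 1 - N%:R * x <= (1 - x) ^+ N.
Proof.
move=> /andP[x0 x1]; elim: N => [|N IH]; first by rewrite mul0r subr0 expr0.
have := ler_wpM2l (_ : 0 <= 1 - x) IH; rewrite subr_ge0 => /(_ x1).
rewrite exprS; apply: le_trans; rewrite -natr1.
have : 0 <= N%:R * x * x by rewrite !mulr_ge0.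
lra.
Qed.

(** Upper companion of Bernoulli's inequality: the induction step is (1 - x)(1 + (N + 1) x) <= 1 + N
    x. *)
Lemma bernoulli_le (x : R) N : 0 <= x <= 1 -> (1 - x) ^+ N * (1 + N%:R * x) <= 1.
Proof.
move=> /andP[x0 x1]; elim: N => [|N IH]; first by rewrite mul0r addr0 expr0 mulr1.
apply: le_trans IH; rewrite exprS mulrAC mulrC ler_wpM2l ?exprn_ge0 ?subr_ge0//.
rewrite -natr1; have : 0 <= N%:R * x * x by rewrite !mulr_ge0.
have : 0 <= x * x by rewrite mulr_ge0.
lra.
Qed.

(** Bernoulli's inequality bounds the value below by 1 - (cu)^n. *)
Lemma step_poly_cvg1 c u : 1 < c -> 0 <= u -> c * u < 1 ->
  (step_poly c n).[u] @[n --> \oo] --> (1 : R).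
Proof.
move=> c1 u0 cu; have u1 : u <= 1.
  rewrite -(ler_pM2l (lt_trans ltr01 c1)) mulr1; lra.
have cc : (fun n => 1 - (c * u) ^+ n) @ \oo --> (1 - 0 : R).
  apply: cvgB; first exact: cvg_cst.
  by apply: cvg_expr; rewrite ger0_norm// mulr_ge0//; lra.
rewrite subr0 in cc.
apply: (squeeze_cvgr _ cc); last exact: cvg_cst.
near=> n; apply/andP; split; last by apply: step_poly_le1; rewrite u0.
rewrite horner_step_poly (le_trans _ (bernoulli_ge _ _ _))//.
  rewrite lerB// exprMn ler_wpM2r ?exprn_ge0//.
  rewrite Num.Theory.truncn_le ?exprn_ge0//; lra.
by rewrite exprn_ge0//= exprn_ile1.
Unshelve. all: by end_near. Qed.

Lemma step_poly_cvg0 c u : 1 < c -> 0 <= u <= 1 -> 1 < c * u ->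
  (step_poly c n).[u] @[n --> \oo] --> (0 : R).
Proof.
move=> c1 /andP[u0 u1] cu.
have cc : (fun n => (c * u)^-1 ^+ n) @ \oo --> (0 : R).
  apply: cvg_expr; rewrite ger0_norm ?invr_ge0 ?invf_lt1//; lra.
apply: (squeeze_cvgr _ _ cc); last exact: cvg_cst.
near=> n; apply/andP; split; first by apply: step_poly_ge0; rewrite u0.
have un : 0 <= u ^+ n <= 1 by rewrite exprn_ge0//= exprn_ile1.
have := bernoulli_le _ (Num.truncn (c ^+ n)) un.
rewrite horner_step_poly; set q := _ ^+ Num.truncn _ => h.
have q0 : 0 <= q by rewrite exprn_ge0// subr_ge0; case/andP: un.
rewrite exprVn -[leRHS]mul1r ler_pdivlMr ?exprn_gt0//; last by lra.
apply: le_trans h; rewrite ler_wpM2l// exprMn.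
(* Replacing c^n by its integer part costs at most u^n <= 1, which the summand 1 of [bernoulli_le]
   absorbs; the value is thus at most (cu)^(-n). *)
have : c ^+ n <= (Num.truncn (c ^+ n))%:R + 1.
  by rewrite natr1 ltW// truncnS_gt.
case/andP: un => un0 un1.
move=> /(ler_wpM2r un0); lra.
Unshelve. all: by end_near. Qed.

End step_polynomials.

(** * Injectivity of the Stieltjes transform *)

Section real_integrals.
Context {d} {T : measurableType d} {R : realType}.
Variable mu : {measure set T -> \bar R}.
Implicit Types f g : T -> R.

Lemma le_integrable_EFin (D : set T) f g : measurable D -> measurable_fun D f ->
  (forall x, D x -> `|f x| <= g x) -> mu.-integrable D (EFin \o g) ->
  mu.-integrable D (EFin \o f).
Proof.
move=> mD mf fg; apply: le_integrable => //; first exact/measurable_EFinP.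
by move=> x Dx /=; rewrite lee_fin (le_trans (fg _ Dx))// ler_norm.
Qed.

Import HBNNSimple.

(* No measurability is required of [f] and [g]: the integral of a nonnegative
   function is a supremum over simple functions, whatever the function. *)
Lemma ge0_eq_integral_off_null (N : set T) (f g : T -> \bar R) :
  measurable N -> mu N = 0%E ->
  (forall x, (0 <= f x)%E) -> (forall x, (0 <= g x)%E) ->
  (forall x, ~ N x -> f x = g x) -> (\int[mu]_x f x = \int[mu]_x g x)%E.
Proof.
move=> mN N0; have mNc : measurable (~` N) by exact: measurableC.
suff le_fg (p q : T -> \bar R) : (forall x, 0 <= p x)%E ->
    (forall x, 0 <= q x)%E -> (forall x, ~ N x -> p x = q x) ->
    (\int[mu]_x p x <= \int[mu]_x q x)%E.
  move=> f0 g0 fg; apply/eqP; rewrite eq_le !le_fg// => x Nx.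
  by rewrite fg.
move=> p0 q0 pq; rewrite ge0_integralTE//; apply: ge_ereal_sup => _ [h /= hp <-].
rewrite ge0_integralTE//.
(* Cut off on [N], the simple function lies below [q]; being measurable, it keeps its integral. *)
apply: le_trans (_ : sintegral mu (proj_nnsfun h mNc) <= _)%E; last first.
  apply: ereal_sup_ubound; exists (proj_nnsfun h mNc) => //= x.
  rewrite /mindic indicE; have [xN|xN] := boolP (x \in ~` N).
    by rewrite mulr1 -pq//; rewrite inE in xN.
  by rewrite mulr0.
have int (k : {nnsfun T >-> R}) : sintegral mu k = (\int[mu]_x (k x)%:E)%E.
  by rewrite integral_nnsfun// patch_setT.
rewrite !int le_eqVlt; apply/orP; left; apply/eqP.
apply: ge0_ae_eq_integral => //.
- exact/measurable_EFinP.
- exact/measurable_EFinP.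
- by move=> x _; rewrite lee_fin.
- by move=> x _; rewrite lee_fin.
exists N; split => // x /= /not_implyP[_] h1; apply: contrapT => Nx; apply: h1.
by rewrite /= /mindic indicE mem_set// mulr1.
Qed.

(** It lets a merely Lebesgue measurable [f] be replaced by a Borel function, and the origin, where
    [sphere_proj] degenerates, be ignored. *)
Lemma eq_integral_off_null (N : set T) (f g : T -> \bar R) :
  measurable N -> mu N = 0%E ->
  (forall x, ~ N x -> f x = g x) -> (\int[mu]_x f x = \int[mu]_x g x)%E.
Proof.
move=> mN N0 fg; rewrite integralE [RHS]integralE.
by congr (_ - _)%E; apply: (@ge0_eq_integral_off_null N) => // x Nx;
  rewrite ?funeposE ?funenegE fg.
Qed.

End real_integrals.

Section stieltjes_injectivity.
Context {d} {T : measurableType d} {R : realType}.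
Variables (mu : {measure set T -> \bar R}) (w G : T -> R) (s : R).
Implicit Types (x : T) (a t c rho : R).
Hypothesis mw : measurable_fun setT w.
Hypothesis w_ge0 : forall x, 0 <= w x.
Hypothesis mG : measurable_fun setT G.
Hypothesis s_gt0 : 0 < s.

(** Its integral is, in t, the generalized Stieltjes transform of order [a] of the image under [w]
    of the signed measure [G mu]. In the application w is r^2 and t is h^2. *)
Let ker a t x := (w x + t) `^ (- a) * G x.

Let ker_null a := forall t, 0 < t ->
  mu.-integrable setT (EFin \o ker a t) /\ \int[mu]_x (ker a t x) = 0.

Let measurable_ker a t : measurable_fun setT (ker a t).
Proof.
apply: measurable_funM => //.
apply: (measurableT_comp (measurable_powR _)).
exact: measurable_funD.
Qed.

Let wt_gt0 t x : 0 < t -> 0 < w x + t.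
Proof. by move=> t0; rewrite ltr_wpDl. Qed.

Let kerS a t x : 0 < t -> ker (a + 1) t x = (w x + t)^-1 * ker a t x.
Proof.
move=> t0; rewrite /ker mulrA; congr (_ * _).
have n0 : w x + t != 0 by rewrite gt_eqF ?wt_gt0.
rewrite opprD powRD ?n0 ?implybT// mulrC.
by rewrite powR_inv1// (ltW (wt_gt0 _ _ t0)).
Qed.

Let integrable_kerS a t : 0 < t -> mu.-integrable setT (EFin \o ker a t) ->
  mu.-integrable setT (EFin \o ker (a + 1) t).
Proof.
move=> t0 iK.
apply: (@le_integrable_EFin _ _ _ _ _ _ (fun x => t^-1 * `|ker a t x|)) => //.
  move=> x _; rewrite kerS// normrM normfV ler_wpM2r// gtr0_norm ?wt_gt0//.
  by rewrite lef_pV2 ?posrE ?wt_gt0// lerDr.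
by have := integrableZl measurableT t^-1 (integrable_norm iK).
Qed.

(* Differentiation in [t], with the derivative read off the second order bound
   [powRN_taylor] integrated against [G]. *)
Let ker_nullS a : 0 < a -> ker_null a -> ker_null (a + 1).
Proof.
move=> a0 Na t t0; have [iK K0] := Na _ t0.
have iK1 := integrable_kerS _ _ t0 iK; have iK2 := integrable_kerS _ _ t0 iK1.
split=> //; apply/eqP; rewrite -normr_le0; apply/ler_addgt0Pr => e e0.
set I := \int[mu]_x _; rewrite add0r.
pose C := a * ((a + 1) * 2 `^ (a + 2)).
pose J := \int[mu]_x `|ker (a + 1 + 1) t x|.
have J0 : 0 <= J by apply: Rintegral_ge0.
have C0 : 0 <= C by rewrite /C !mulr_ge0 ?powR_ge0 ?addr_ge0// ltW.
suff key (del : R) : 0 < del -> del <= t / 2 -> a * `|I| <= C * del * J.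
  (* Chosen so that C del J <= a e; the added 1 keeps the denominator positive when C J = 0. *)
  pose del := Num.min (t / 2) (a * e / (C * J + 1)).
  have CJ : 0 < C * J + 1 by rewrite ltr_wpDl// mulr_ge0.
  have del0 : 0 < del by rewrite lt_min !divr_gt0// mulr_gt0.
  have /(key _ del0) : del <= t / 2 by rewrite ge_min lexx.
  have : del * (C * J + 1) <= a * e.
    by rewrite -ler_pdivlMr// ge_min lexx orbT.
  move=> h1 h2; rewrite -(ler_pM2l a0); apply: (le_trans h2); lra.
move=> del0 delt.
have td : 0 < t + del by rewrite addr_gt0.
have [iKd Kd0] := Na _ td.
(* The transform vanishes at both t and t + del, so the linear term alone has the integral of the
   Taylor remainder. *)
have E : \int[mu]_x (ker a (t + del) x - ker a t x + (a * del) * ker (a + 1) t x)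
    = a * del * I.
  rewrite RintegralD//=; last 2 first.
  - by have := integrableB measurableT iKd iK.
  - by have := integrableZl measurableT (a * del) iK1.
  by rewrite RintegralB// Kd0 K0 subrr add0r RintegralZl.
have : `|a * del * I| <= C * del ^+ 2 * J.
  rewrite -E /J -RintegralZl//; last exact: integrable_norm.
  have iE : mu.-integrable setT (EFin \o (fun x => ker a (t + del) x - ker a t x +
      (a * del) * ker (a + 1) t x)).
    have := integrableD measurableT (integrableB measurableT iKd iK)
      (integrableZl measurableT (a * del) iK1).
    by [].
  apply: le_trans (le_normr_Rintegral measurableT iE) _.
  apply: le_Rintegral => //.
  - exact: integrable_norm.
  - have := integrableZl measurableT (C * del ^+ 2) (integrable_norm iK2).
    by [].
  move=> x _; rewrite /ker.
  have -> : (w x + (t + del)) `^ (- a) * G x - (w x + t) `^ (- a) * G x +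
      a * del * ((w x + t) `^ (- (a + 1)) * G x) =
      ((w x + t + del) `^ (- a) - (w x + t) `^ (- a) +
        a * del * (w x + t) `^ (- a - 1)) * G x.
    by rewrite opprD addrA; ring.
  rewrite normrM [X in _ <= _ * X]normrM !mulrA ler_wpM2r//.
  rewrite [X in _ <= _ * X]ger0_norm ?powR_ge0//.
  apply: le_trans (powRN_taylor _ _ _ (ltW a0) (wt_gt0 _ _ t0) _) _.
    rewrite gtr0_norm//; apply: (le_trans delt).
    by rewrite ler_pM2r// lerDr.
  rewrite -/C !mulrA le_eqVlt; apply/orP; left; apply/eqP.
  by congr (_ * _ `^ _); ring.
rewrite !normrM (gtr0_norm a0) (gtr0_norm del0) => h.
rewrite -(ler_pM2l del0); apply: le_trans (_ : _ <= C * del ^+ 2 * J) _; lra.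
Qed.

Hypothesis stieltjes0 : ker_null s.

Let ker_null_nat n : ker_null (s + n%:R).
Proof.
elim: n => [|n IH]; first by rewrite addr0.
by rewrite -natr1 addrA; apply: ker_nullS => //; rewrite ltr_wpDr.
Qed.

(** By [kerS] at t = 1, a factor X of the polynomial raises the exponent by 1; hence [n] is general
    in the induction. *)
Let poly_null (p : {poly R}) n :
  let F x := p.[(w x + 1)^-1] * ker (s + n%:R) 1 x in
  mu.-integrable setT (EFin \o F) /\ \int[mu]_x (F x) = 0.
Proof.
elim/poly_ind: p n => [|p c IH] n /=.
  have -> : (fun x => 0.[(w x + 1)^-1] * ker (s + n%:R) 1 x) = cst 0.
    by apply/funext => x; rewrite horner0 mul0r.
  by split; [exact: integrable0|rewrite /Rintegral integral0].
have [iI I0] := IH n.+1.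
have [iK K0] := ker_null_nat n _ ltr01.
have -> : (fun x => (p * 'X + c%:P).[(w x + 1)^-1] * ker (s + n%:R) 1 x) =
  fun x => p.[(w x + 1)^-1] * ker (s + n.+1%:R) 1 x + c * ker (s + n%:R) 1 x.
  by apply/funext => x; rewrite -natr1 addrA kerS// hornerMXaddC; ring.
have iZ := integrableZl measurableT c iK.
split; first by have := integrableD measurableT iI iZ.
by rewrite RintegralD// I0 add0r RintegralZl// K0 mulr0.
Qed.

(** With c = rho + 1 and u = 1/(w + 1), u < 1/c says w > rho, so the step polynomials tend to the
    indicator of the tail. At w = rho they tend to 1/e instead, whence the condition on this level
    set. *)
Lemma stieltjes_tail_eq0 rho : 0 < rho -> mu (w @^-1` [set rho]) = 0%E ->
  \int[mu]_(x in [set x | rho < w x]) ((w x + 1) `^ (- s) * G x) = 0.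
Proof.
move=> rho0 nrho; pose c := rho + 1.
have c1 : 1 < c by rewrite /c ltrDr.
have u01 x : 0 <= (w x + 1)^-1 <= 1.
  by rewrite invr_ge0 (ltW (wt_gt0 _ _ ltr01))//= invf_le1 ?wt_gt0// lerDr.
have mE : measurable [set x | rho < w x].
  rewrite (_ : [set _ | _] = w @^-1` `]rho, +oo[).
    by rewrite -[X in measurable X]setTI; exact: mw.
  by apply/seteqP; split => x /=; rewrite in_itv/= andbT.
rewrite Rintegral_mkcond.
pose F n x := ((step_poly c n).[(w x + 1)^-1] * ker s 1 x)%:E.
have [iK _] := stieltjes0 _ ltr01.
have mK := measurable_ker s 1.
have mF n : measurable_fun setT (F n).
  have [/measurable_int] := poly_null (step_poly c n) 0; rewrite /= addr0.
  by [].
have Fcvg : {ae mu, forall x, setT x ->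
    F ^~ x @ \oo --> (EFin \o (ker s 1 \_ [set x | rho < w x])) x}.
  exists (w @^-1` [set rho]); split => //.
    by rewrite -[X in measurable X]setTI; exact: mw.
  move=> x /= /not_implyP[_] h; apply: contrapT => wx; apply: h.
  apply: cvg_EFin; first by near=> n.
  rewrite (_ : fine \o _ = fun n => (step_poly c n).[(w x + 1)^-1] * ker s 1 x)//.
  rewrite /patch; case: ifPn => [|]; rewrite ?inE/= ?notin_setE/=.
    move=> rw; rewrite -[X in _ --> X]mul1r; apply: cvgMr_tmp.
    apply: step_poly_cvg1 => //; first by case/andP: (u01 x).
    by rewrite /c ltr_pdivrMr ?wt_gt0// mul1r ltrD2r.
  move=> /negP; rewrite -leNgt => rw.
  rewrite -[X in _ --> X](mul0r (ker s 1 x)); apply: cvgMr_tmp.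
  apply: step_poly_cvg0 => //.
  rewrite /c ltr_pdivlMr ?wt_gt0// mul1r ltrD2r lt_neqAle rw andbT.
  exact/eqP.
have FK : {ae mu, forall x n, setT x -> (`|F n x| <= `|ker s 1 x|%:E)%E}.
  apply: aeW => x n _; rewrite /F /= lee_fin normrM ler_piMl//.
  by rewrite ger0_norm ?step_poly_ge0 ?step_poly_le1.
have mKE : measurable_fun setT (EFin \o (ker s 1 \_ [set x | rho < w x])).
  apply/measurable_EFinP/(measurable_restrictT _ _).1 => //.
  exact: measurable_funS mK.
have [_ _] := dominated_convergence measurableT mF mKE Fcvg (integrable_norm iK) FK.
rewrite (_ : (fun n => _) = cst 0%E); last first.
  apply/funext => n /=; have [ip p0] := poly_null (step_poly c n) 0.
  rewrite -[LHS]fineK; last by have := integrable_fin_num measurableT ip; rewrite addr0.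
  by move: p0; rewrite /= addr0 /Rintegral /F => ->.
move/cvg_lim => /(_ (@ereal_hausdorff R)).
by rewrite [X in X = _ -> _]lim_cst// /Rintegral => <-.
Unshelve. all: by end_near. Qed.

End stieltjes_injectivity.

(** * Lebesgue measure on row vectors *)

Section lebesgue_rV_theory.
Context {R : realType}.

(** The image of Lebesgue measure under multiplication by t, times t, gives each ]a, b] its length,
    so it is Lebesgue measure. *)
Lemma ge0_integral_scale (t : R) (phi : R -> \bar R) : 0 < t ->
  measurable_fun setT phi -> (forall x, 0 <= phi x)%E ->
  (t%:E * \int[lebesgue_measure]_x phi (t * x)%R =
    \int[lebesgue_measure]_x phi x)%E.
Proof.
move=> t0 mphi phi0.
have mt : measurable_fun setT (fun x : measurableTypeR R => t * x : measurableTypeR R).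
  exact: measurable_funM.
pose P : {measure set (measurableTypeR R) -> \bar R} :=
  measure_function_pushforward__canonical__measure_function_Measure lebesgue_measure mt.
pose nu := mscale (NngNum (ltW t0)) P.
have -> : (\int[lebesgue_measure]_x phi x = \int[nu]_x phi x)%E.
  apply: eq_measure_integral => A mA _; apply: lebesgue_measure_unique => //.
  move=> _ [[a b] _ <-] /=.
  rewrite /nu /mscale /= /pushforward.
  have -> : (fun x : R => t * x) @^-1` `]a, b]%classic = `]a / t, b / t]%classic.
    apply/seteqP; split => x /=; rewrite !in_itv/= => /andP[].
      by rewrite ltr_pdivrMr// ler_pdivlMr// mulrC => -> ->.
    by rewrite ltr_pdivrMr// ler_pdivlMr// (mulrC x) => -> ->.
  rewrite !lebesgue_measure_itv/= !lte_fin ltr_pM2r ?invr_gt0//.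
  case: ifP => _; last by rewrite mule0.
  by rewrite -!EFinD -EFinM -mulrBl mulrC divfK// gt_eqF.
by rewrite ge0_integral_mscale// ge0_integral_pushforward.
Qed.

Lemma ge0_integral_lebesgue_rVS m (phi : 'rV[R]_m.+1 -> \bar R) :
  measurable_fun setT phi -> (forall x, 0 <= phi x)%E ->
  (\int[lebesgue_rV R m.+1]_x phi x =
   \int[lebesgue_measure]_a \int[lebesgue_rV R m]_y phi (cons_rV (a, y)))%E.
Proof.
move=> mphi phi0.
have mc := @measurable_cons_rV R m.
pose P : {measure set 'rV[R]_m.+1 -> \bar R} :=
  measure_function_pushforward__canonical__measure_function_Measure
    (lebesgue_measure \x lebesgue_rV R m)%E mc.
transitivity (\int[P]_x phi x)%E; first by [].
rewrite ge0_integral_pushforward//.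
have hm : measurable_fun setT (phi \o @cons_rV R m) by exact: (measurableT_comp mphi mc).
by rewrite preimage_setT (fubini_tonelli1 _ hm (fun z => phi0 _)).
Qed.

Lemma measurable_integral_cons_rV m (phi : 'rV[R]_m.+1 -> \bar R) :
  measurable_fun setT phi -> (forall x, 0 <= phi x)%E ->
  measurable_fun setT (fun a : measurableTypeR R =>
    \int[lebesgue_rV R m]_y phi (cons_rV (a, y)))%E.
Proof.
move=> mphi phi0.
apply: (measurable_fun_fubini_tonelli_F (phi \o @cons_rV R m)) => [|x].
  exact: (measurableT_comp mphi (@measurable_cons_rV R m)).
exact: phi0.
Qed.

Lemma measurable_fun_scale_rV d (T : measurableType d) m (a : T -> R)
    (v : T -> 'rV[R]_m) : measurable_fun setT a -> measurable_fun setT v ->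
  measurable_fun setT (fun x => a x *: v x).
Proof.
move=> ma mv; apply: measurable_fun_rV => i; under eq_fun do rewrite mxE.
by apply: measurable_funM => //; exact: (measurableT_comp (measurable_coord i)).
Qed.

Lemma ge0_integral_scale_rV m (t : R) (phi : 'rV[R]_m -> \bar R) : 0 < t ->
  measurable_fun setT phi -> (forall x, 0 <= phi x)%E ->
  ((t ^+ m)%:E * \int[lebesgue_rV R m]_x phi (t *: x)%R =
    \int[lebesgue_rV R m]_x phi x)%E.
Proof.
move=> t0; elim: m phi => [|m IH] phi mphi phi0.
  rewrite expr0 mul1e; apply: eq_integral => x _.
  by congr phi; apply/rowP; case.
have mt : measurable_fun setT (fun x : 'rV[R]_m.+1 => t *: x).
  exact: measurable_fun_scale_rV.
rewrite !ge0_integral_lebesgue_rVS//; last exact: measurableT_comp.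
have mG : measurable_fun setT (fun a : measurableTypeR R =>
    \int[lebesgue_rV R m]_y phi (cons_rV (a, y)))%E.
  exact: measurable_integral_cons_rV.
rewrite -(ge0_integral_scale _ _ t0 mG); last first.
  by move=> a; exact: integral_ge0.
rewrite exprS EFinM -muleA; congr (_ * _)%E.
rewrite -ge0_integralZl//; last 3 first.
- apply: (measurable_integral_cons_rV m (fun x => phi (t *: x))) => //.
  exact: measurableT_comp.
- by move=> a _; exact: integral_ge0.
- by rewrite lee_fin exprn_ge0// ltW.
apply: eq_integral => a _.
rewrite -[RHS]IH//; last first.
  apply: measurableT_comp => //.
  apply: (measurableT_comp (@measurable_cons_rV R m)).
  exact: measurable_fun_pair.
congr (_ * _)%E; apply: eq_integral => y _; congr phi.
apply/rowP => i; have [j ->|->] := unliftP ord0 i.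
  by rewrite mxE !cons_rVS /= mxE.
by rewrite mxE !cons_rV0.
Qed.

(** A sup-norm ball, with explicit volume: comparison with it shows that the unit ball has finite
    positive volume and that the origin is null. *)
Definition cube_rV m (c : R) : set 'rV[R]_m :=
  [set x | forall i, `|x ord0 i| <= c].

Lemma measurable_cube_rV m c : measurable (cube_rV m c).
Proof.
rewrite (_ : cube_rV m c = \bigcap_(i in [set: 'I_m])
    ((fun x : 'rV[R]_m => x ord0 i) @^-1` `[- c, c])).
  apply: fin_bigcap_measurable => // i _; rewrite -[X in measurable X]setTI.
  exact: measurable_coord.
apply/seteqP; split => [x xc i _|x xc i]; first by rewrite /= in_itv/= -ler_norml.
by have := xc i Logic.I; rewrite /= in_itv/= -ler_norml.
Qed.

Lemma lebesgue_rV_cube m c : 0 <= c ->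
  lebesgue_rV R m (cube_rV m c) = ((2 * c) ^+ m)%:E.
Proof.
move=> c0; elim: m => [|m IH].
  by rewrite /= diracE mem_set//; case.
rewrite /= /lebesgue_rVS /pushforward.
have -> : @cons_rV R m @^-1` cube_rV m.+1 c = `[- c, c] `*` cube_rV m c.
  apply/seteqP; split => [[a y] /= h|[a y] /= [ac yc] i].
    split; first by rewrite in_itv/= -ler_norml -[a]/((a, y).1) -cons_rV0.
    by move=> i; have := h (lift ord0 i); rewrite cons_rVS.
  have [j ->|->] := unliftP ord0 i; first by rewrite cons_rVS.
  by rewrite cons_rV0/= ler_norml; rewrite in_itv in ac.
rewrite product_measure1E//; last exact: measurable_cube_rV.
rewrite IH [X in (X * _)%E](_ : _ = lebesgue_measure `[(- c)%R, c]%classic)//.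
rewrite lebesgue_measure_itv/= lte_fin.
have [cc|cc] := ltP (- c) c; first by rewrite -EFinD -EFinM exprS; congr (_ * _)%:E; ring.
have -> : c = 0 by apply: le_anti; rewrite c0 andbT; lra.
by rewrite mul0e mulr0 exprS mul0r.
Qed.

Lemma enorm_ge0 m (x : 'rV[R]_m) : 0 <= enorm x.
Proof. exact: sqrtr_ge0. Qed.

Lemma sqr_enorm m (x : 'rV[R]_m) : enorm x ^+ 2 = \sum_(i < m) x ord0 i ^+ 2.
Proof. by rewrite sqr_sqrtr// sumr_ge0// => i _; rewrite sqr_ge0. Qed.

Lemma coord_le_enorm m (x : 'rV[R]_m) i : `|x ord0 i| <= enorm x.
Proof.
rewrite -sqrtr_sqr ler_wsqrtr// (bigD1 i)//= lerDl sumr_ge0// => j _.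
exact: sqr_ge0.
Qed.

Lemma enormZ m (a : R) (x : 'rV[R]_m) : enorm (a *: x) = `|a| * enorm x.
Proof.
rewrite /enorm -sqrtr_sqr -sqrtrM ?sqr_ge0// mulr_sumr; congr Num.sqrt.
by apply: eq_bigr => i _; rewrite mxE exprMn.
Qed.

Lemma enorm0 m : enorm (0 : 'rV[R]_m) = 0.
Proof. by rewrite -(scale0r 0) enormZ normr0 mul0r. Qed.

Lemma enorm_eq0 m (x : 'rV[R]_m) : (enorm x == 0) = (x == 0).
Proof.
apply/idP/idP => [/eqP x0|/eqP ->]; last by rewrite enorm0.
apply/eqP/rowP => i; rewrite mxE; apply/eqP.
by rewrite -normr_le0 -x0 coord_le_enorm.
Qed.

Lemma coord_le_norm m (x : 'rV[R]_m) i : `|x ord0 i| <= `|x|.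
Proof.
rewrite -[leRHS]/(mx_norm x) mx_normrE.
exact: (@le_bigmax _ _ _ 0 (fun ij : 'I_1 * 'I_m => `|x ij.1 ij.2|) (ord0, i)).
Qed.

Lemma enorm_le_norm m (x : 'rV[R]_m) : enorm x ^+ 2 <= m%:R * `|x| ^+ 2.
Proof.
rewrite sqr_enorm mulr_natl -[X in _ *+ X]card_ord -sumr_const ler_sum// => i _.
rewrite -real_normK ?num_real// lerXn2r ?nnegrE//.
exact: coord_le_norm.
Qed.

Lemma cube_rV0 m : cube_rV m 0 = [set 0].
Proof.
apply/seteqP; split => [x h|x /= -> i]; last by rewrite mxE normr0.
by apply/rowP => i; rewrite mxE; apply/eqP; rewrite -normr_le0 h.
Qed.

Lemma lebesgue_rV_origin m : (0 < m)%N -> lebesgue_rV R m [set 0] = 0%E.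
Proof.
by move=> m0; rewrite -cube_rV0 lebesgue_rV_cube// mulr0 expr0n gtn_eqF.
Qed.

Lemma measurable_origin m : measurable [set (0 : 'rV[R]_m)].
Proof. by rewrite -cube_rV0; exact: measurable_cube_rV. Qed.

Lemma mem_unit_ball m (x : 'rV[R]_m) :
  (x \in @unit_ball R m) = (enorm x <= 1).
Proof. by apply/idP/idP; rewrite inE. Qed.

Lemma lebesgue_rV_unit_ball_lty m : (lebesgue_rV R m (@unit_ball R m) < +oo)%E.
Proof.
apply: (@le_lt_trans _ _ (lebesgue_rV R m (cube_rV m 1))).
  apply: le_measure; rewrite ?inE//; [exact: measurable_unit_ball|exact: measurable_cube_rV|].
  by move=> x xB i; apply: le_trans xB; exact: coord_le_enorm.
by rewrite lebesgue_rV_cube// ltry.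
Qed.

Lemma lebesgue_rV_unit_ball_gt0 m : (0 < lebesgue_rV R m (@unit_ball R m))%E.
Proof.
(* On this cube |x|^2 <= m/(m + 1), and its half side is defined and positive for m = 0 too. *)
apply: (@lt_le_trans _ _ (lebesgue_rV R m (cube_rV m m.+1%:R^-1))).
  by rewrite lebesgue_rV_cube// lte_fin exprn_gt0.
apply: le_measure; rewrite ?inE//; [exact: measurable_cube_rV|exact: measurable_unit_ball|].
move=> x xc; rewrite /unit_ball /= -(@ler_pXn2r _ 2) ?nnegrE ?enorm_ge0//.
rewrite sqr_enorm expr1n.
apply: (@le_trans _ _ (\sum_(i < m) m.+1%:R^-1)).
  apply: ler_sum => i _; rewrite -real_normK ?num_real//.
  apply: (@le_trans _ _ (m.+1%:R^-1 ^+ 2)); first by rewrite lerXn2r ?nnegrE.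
  by rewrite expr2 ler_piMl// invf_le1// ler1n.
by rewrite sumr_const card_ord -(mulr_natl _ m) ler_pdivrMr// mul1r ler_nat leqnSn.
Qed.

End lebesgue_rV_theory.

(** * Polar coordinates *)

Section tail_integral.
Context {R : realType}.

(** The antiderivative -t^(-n) vanishes at infinity. *)
Lemma integral_invrX_tail (n : nat) (a : R) : (0 < n)%N -> 0 < a ->
  (\int[lebesgue_measure]_(t in `[a, +oo[) (n%:R * (t^-1) ^+ n.+1)%:E =
    ((a^-1) ^+ n)%:E)%E.
Proof.
case: n => [//|n] _ a0; pose F (t : R) := - (t^-1) ^+ n.+1.
have dF (x : R) : 0 < x -> is_derive x (1 : R) F (n.+1%:R * (x^-1) ^+ n.+2).
  move=> x0; have xn0 : x != 0 by rewrite gt_eqF.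
  have dV : is_derive x (1 : R) (fun t : R => t^-1) (- x ^- 2 *: 1).
    exact: (is_deriveV (f := id)).
  have := is_deriveN (is_deriveX n.+1 dV).
  rewrite (_ : - _ = F); last first.
    by apply/funext => t; rewrite /F /= exprfctE.
  move=> h; apply: is_derive_eq h _.
  rewrite /= -[LHS]/(- (n.+1%:R * (x^-1) ^+ n * (- x ^- 2 * 1))) mulr1 -exprVn.
  by rewrite mulrN opprK -mulrA -exprD addn2.
have cF (x : R) : 0 < x -> {for x, continuous F}.
  by move=> x0; apply/differentiable_continuous/derivable1_diffP; apply: ex_derive; exact: dF.
rewrite (@ge0_continuous_FTC2y _ _ F a 0).
- by rewrite sub0e /F -EFinN opprK.
- by move=> x ax; rewrite mulr_ge0// exprn_ge0// invr_ge0 ltW// (lt_le_trans a0).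
- apply: continuous_in_subspaceT => x /set_mem/=; rewrite in_itv/= andbT => ax.
  have x0 : x != 0 by rewrite gt_eqF// (lt_le_trans a0).
  apply: cvgM; first exact: cvg_cst.
  apply: (@continuous_comp _ _ _ (fun t : R => t^-1) (fun y => y ^+ n.+2)).
    by apply: inv_continuous.
  exact: exprn_continuous.
- have c0 : (fun t : R => t^-1) @ +oo --> 0.
    apply/cvgrPdist_lt => e e0; near=> t.
    have t0 : 0 < t by near: t; exact: nbhs_pinfty_gt.
    rewrite sub0r normrN gtr0_norm ?invr_gt0// invf_plt ?posrE//.
    by near: t; apply: nbhs_pinfty_gt; rewrite num_real.
  rewrite -oppr0; apply: cvgN.
  have : (fun t : R => (t^-1) ^+ n.+1) @ +oo --> (0 : R) ^+ n.+1.
    apply: (@cvg_comp _ _ _ (fun t : R => t^-1) (fun y => y ^+ n.+1) _ (nbhs (0 : R))) => //.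
    exact: exprn_continuous.
  by rewrite expr0n.
- by move=> x ax; apply: ex_derive; apply: dF; exact: lt_trans ax.
- by apply: cvg_at_right_filter; exact: cF.
- move=> x; rewrite in_itv/= andbT => ax; rewrite derive1E.
  by apply: derive_val; apply: dF; exact: lt_trans ax.
Unshelve. all: by end_near. Qed.

End tail_integral.

Section polar.
Context {R : realType} (m : nat).
Hypothesis m_gt0 : (0 < m)%N.

Local Notation L := (lebesgue_rV R m).
Local Notation la := (@lebesgue_measure R).

Let RV := (measurableTypeR R * 'rV[R]_m)%type.
Implicit Types (z : RV) (phi : 'rV[R]_m -> \bar R).

(** The surface measure of radius r is m r^(m-1) times the image of Lebesgue measure on the unit
    ball under [sphere_proj r]. Polar coordinates are therefore pairs (r, x) with x in the ball, not
    on the sphere, and this is their density. *)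
Definition polar_weight z : R :=
  (0 < z.1)%R%:R * (enorm z.2 <= 1)%R%:R * (m%:R * z.1 ^+ m.-1).

(** [psi] is the density after r = t|x|, which turns r^(m-1) dr into t^(m-1) |x|^m dt; [omega] is
    the density after the further substitution y = tx, of Jacobian t^m. *)
Let psi z : R :=
  (0 < z.1)%R%:R * (enorm z.2 <= 1)%R%:R * (m%:R * z.1 ^+ m.-1 * enorm z.2 ^+ m).

Let omega z : R :=
  (0 < z.1)%R%:R * (enorm z.2 <= z.1)%R%:R * (m%:R * (z.1^-1) ^+ m.+1 * enorm z.2 ^+ m).

Lemma measurable_natr_bool d (T : measurableType d) (b : T -> bool) :
  measurable_fun setT b -> measurable_fun setT (fun x => (b x)%:R : R).
Proof. by move=> mb; apply: (measurableT_comp (f := fun b : bool => b%:R : R)). Qed.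

Lemma measurable_fun_invr : measurable_fun setT (fun x : R => x^-1).
Proof.
(* At 0 both indicators vanish, in agreement with the convention 0^-1 = 0. *)
rewrite (_ : (fun _ => _) = fun x : R => (0 < x)%R%:R * x `^ (-1) - (x < 0)%R%:R * (- x) `^ (-1)).
  apply: measurable_funB; apply: measurable_funM.
  - apply: measurable_natr_bool; exact: measurable_fun_ltr.
  - exact: measurable_powR.
  - apply: measurable_natr_bool; exact: measurable_fun_ltr.
  - by apply: (measurableT_comp (measurable_powR _)).
apply/funext => x; have [x0|x0|->] := ltgtP x 0.
- by rewrite mul0r add0r mul1r powR_inv1 ?oppr_ge0 1?ltW// invrN opprK.
- by rewrite mul0r subr0 mul1r powR_inv1// ltW.
- by rewrite !mul0r subr0 invr0.
Qed.

Let m1 : measurable_fun setT (fun z : RV => z.1 : R). Proof. exact: measurable_fst. Qed.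
Let mn2 : measurable_fun setT (fun z : RV => enorm z.2).
Proof. exact: (measurableT_comp (@measurable_enorm R m) measurable_snd). Qed.
Let m0lt1 : measurable_fun setT (fun z : RV => (0 < z.1)%R%:R : R).
Proof. by apply: measurable_natr_bool; exact: measurable_fun_ltr. Qed.

Lemma measurable_polar_weight : measurable_fun setT polar_weight.
Proof.
apply: measurable_funM.
  by apply: measurable_funM => //; apply: measurable_natr_bool; exact: measurable_fun_ler.
by apply: measurable_funM => //; exact: measurable_funX.
Qed.

Let mpsi : measurable_fun setT psi.
Proof.
apply: measurable_funM.
  by apply: measurable_funM => //; apply: measurable_natr_bool; exact: measurable_fun_ler.
apply: measurable_funM; last exact: measurable_funX.
by apply: measurable_funM => //; exact: measurable_funX.
Qed.

Let momega : measurable_fun setT omega.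
Proof.
apply: measurable_funM.
  by apply: measurable_funM => //; apply: measurable_natr_bool; exact: measurable_fun_ler.
apply: measurable_funM; last exact: measurable_funX.
apply: measurable_funM => //; apply: measurable_funX.
exact: (measurableT_comp measurable_fun_invr m1).
Qed.

Lemma polar_weight_ge0 z : 0 <= polar_weight z.
Proof.
rewrite /polar_weight; case: ltP => [z0|_]; last by rewrite !mul0r.
by rewrite !mulr_ge0// exprn_ge0// ltW.
Qed.

Let psi_ge0 z : 0 <= psi z.
Proof.
rewrite /psi; case: ltP => [z0|_]; last by rewrite !mul0r.
by rewrite !mulr_ge0// exprn_ge0 ?enorm_ge0// ltW.
Qed.

Let omega_ge0 z : 0 <= omega z.
Proof.
rewrite /omega; case: ltP => [z0|_]; last by rewrite !mul0r.
by rewrite !mulr_ge0// exprn_ge0 ?enorm_ge0// invr_ge0 ltW.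
Qed.

Lemma measurable_sphere_proj2 :
  measurable_fun setT (fun z : RV => sphere_proj z.1 z.2).
Proof.
apply: measurable_fun_scale_rV; last exact: measurable_snd.
by apply: measurable_funM => //; exact: (measurableT_comp measurable_fun_invr mn2).
Qed.

(* Substituting r = t|x| and then y = tx turns the right-hand side into
   int_y phi(y) |y|^m (int_(t >= |y|) m t^(-m-1) dt) dy, and the inner integral is |y|^-m. *)
Lemma ge0_integral_polar phi : measurable_fun setT phi -> (forall x, 0 <= phi x)%E ->
  (\int[L]_y phi y =
   \int[la \x L]_z ((polar_weight z)%:E * phi (sphere_proj z.1 z.2)))%E.
Proof.
move=> mphi phi0.
(* The scaling by |x| and the tail integral from |y| both need a nonzero vector. *)
have off0 (g h : 'rV[R]_m -> \bar R) : (forall x, x != 0 -> g x = h x) ->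
    (\int[L]_x g x = \int[L]_x h x)%E.
  move=> gh; apply: (eq_integral_off_null L [set (0 : 'rV[R]_m)]).
  - exact: measurable_origin.
  - exact: lebesgue_rV_origin.
  - by move=> x /eqP; exact: gh.
have Xm (a : R) : a ^+ m = a * a ^+ m.-1 by rewrite -exprS prednK.
have en0 (x : 'rV[R]_m) : x != 0 -> 0 < enorm x.
  by move=> x0; rewrite lt_neqAle enorm_ge0 andbT eq_sym enorm_eq0.
have mphi1 : measurable_fun setT (fun z : RV => phi (sphere_proj z.1 z.2)).
  exact: (measurableT_comp mphi measurable_sphere_proj2).
have mphi2 : measurable_fun setT (fun z : RV => phi (z.1 *: z.2)).
  apply: (measurableT_comp mphi).
  by apply: measurable_fun_scale_rV => //; exact: measurable_snd.
have mphi3 : measurable_fun setT (fun z : RV => phi z.2).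
  exact: (measurableT_comp mphi measurable_snd).
have mA : measurable_fun setT (fun z : RV => ((polar_weight z)%:E * phi (sphere_proj z.1 z.2))%E).
  by apply: emeasurable_funM => //; apply/measurable_EFinP; exact: measurable_polar_weight.
have mB : measurable_fun setT (fun z : RV => ((psi z)%:E * phi (z.1 *: z.2))%E).
  by apply: emeasurable_funM => //; exact/measurable_EFinP.
have mC : measurable_fun setT (fun z : RV => ((omega z)%:E * phi z.2)%E).
  by apply: emeasurable_funM => //; exact/measurable_EFinP.
have A0 z : (0 <= (polar_weight z)%:E * phi (sphere_proj z.1 z.2))%E.
  by rewrite mule_ge0// lee_fin polar_weight_ge0.
have B0 z : (0 <= (psi z)%:E * phi (z.1 *: z.2))%E by rewrite mule_ge0// lee_fin.
have C0 z : (0 <= (omega z)%:E * phi z.2)%E by rewrite mule_ge0// lee_fin.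
have mX1 (f : RV -> \bar R) x : measurable_fun setT f ->
    measurable_fun setT (fun t : measurableTypeR R => f (t, x)).
  by move=> mf; apply: (measurableT_comp mf); exact: measurable_pair2.
have mX2 (f : RV -> \bar R) t : measurable_fun setT f ->
    measurable_fun setT (fun x => f (t, x)).
  by move=> mf; apply: (measurableT_comp mf); exact: measurable_pair1.
apply/esym; rewrite (fubini_tonelli2 _ mA A0).
transitivity (\int[L]_x \int[la]_t ((psi (t, x))%:E * phi (t *: x)))%E.
  apply: off0 => x x0; have xp := en0 _ x0.
  rewrite /fubini_G -(ge0_integral_scale _ _ xp (mX1 _ x mA)); last by move=> t; exact: A0.
  have sp t : sphere_proj (enorm x * t) x = t *: x.
    by rewrite /sphere_proj mulrC mulKf// gt_eqF.
  rewrite -ge0_integralZl//; last 2 first.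
  - apply: (measurableT_comp (f := fun t => ((polar_weight (t, x))%:E * phi (sphere_proj t x))%E)).
      exact: (mX1 _ x mA).
    exact: measurable_funM.
  - by rewrite lee_fin ltW.
  apply: eq_integral => t _ /=; rewrite sp muleA -EFinM; congr (_%:E * _)%E.
  rewrite /polar_weight /psi /= pmulr_rgt0// exprMn.
  by rewrite (Xm (enorm x)); ring.
transitivity (\int[la]_t \int[L]_x ((psi (t, x))%:E * phi (t *: x)))%E.
  by apply/esym; exact: (fubini_tonelli _ mB B0).
transitivity (\int[la]_t \int[L]_x ((omega (t, x))%:E * phi x))%E.
  apply: eq_integral => t _; have [t0|t0] := ltP 0 t; last first.
    rewrite integral0_eq; last first.
      by move=> x _; rewrite /psi/= ltNge t0/= !mul0r mul0e.
    by rewrite integral0_eq// => x _; rewrite /omega/= ltNge t0/= !mul0r mul0e.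
  rewrite -(ge0_integral_scale_rV _ _ _ t0 (mX2 _ t mC)); last by move=> x; exact: C0.
  rewrite -ge0_integralZl//; last 2 first.
  - apply: (measurableT_comp (f := fun x => ((omega (t, x))%:E * phi x)%E)).
      exact: (mX2 _ t mC).
    exact: measurable_fun_scale_rV.
  - by rewrite lee_fin exprn_ge0// ltW.
  apply: eq_integral => x _; rewrite muleA -EFinM; congr (_%:E * _)%E.
  rewrite /psi /omega /= enormZ (gtr0_norm t0) t0 ger_pMr// exprMn.
  rewrite (exprS (t^-1)) (Xm t) (Xm t^-1).
  have tm : t ^+ m.-1 * t^-1 ^+ m.-1 = 1 by rewrite -exprMn mulfV ?gt_eqF// expr1n.
  have tt : t * t^-1 = 1 by rewrite mulfV// gt_eqF.
  set X := true%:R; set Y := _%:R; set M := m%:R; set e := enorm x ^+ m.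
  transitivity (X * Y * (M * t ^+ m.-1 * e) * (t * t^-1) * (t * t^-1) *
      (t ^+ m.-1 * t^-1 ^+ m.-1)); first by rewrite tm tt !mulr1.
  by move: (t^-1) => t'; ring.
rewrite (fubini_tonelli _ mC C0); apply: off0 => y y0.
have yp := en0 _ y0.
transitivity (\int[la]_(t in `[enorm y, +oo[)
    (((enorm y ^+ m)%:E * phi y) * (m%:R * (t^-1) ^+ m.+1)%:E))%E.
  rewrite [RHS]integral_mkcond; apply: eq_integral => t _.
  rewrite patchE mem_setE in_itv/= andbT /omega /=.
  case: (leP (enorm y) t) => yt; last by rewrite mulr0 mul0r mul0e.
  rewrite (lt_le_trans yp yt) !mul1r mulrC EFinM -!muleA; congr (_ * _)%E.
  by rewrite muleC.
rewrite ge0_integralZl//.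
- rewrite (integral_invrX_tail _ _ m_gt0 yp) muleAC -EFinM exprVn mulfV ?mul1e//.
  by rewrite expf_neq0// gt_eqF.
- apply/measurable_funTS/measurable_EFinP/measurable_funM => //.
  by apply: measurable_funX; exact: measurable_fun_invr.
- move=> t /=; rewrite in_itv/= andbT => yt.
  by rewrite lee_fin mulr_ge0// exprn_ge0// invr_ge0 (le_trans _ yt)// ltW.
- by rewrite mule_ge0// lee_fin exprn_ge0// ltW.
Qed.

End polar.

(** * Positive and negative parts, restricted measures *)

Section ereal_parts.
Context {R : realType}.
Local Open Scope ereal_scope.

Lemma funepos_scaled T (w : T -> R) (f : T -> \bar R) : (forall x, 0 <= w x)%R ->
  (fun x => (w x)%:E * f x)^\+ = (fun x => (w x)%:E * f^\+ x).
Proof.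
move=> w0; apply/funext => x.
(* The factor varies with x, so the rule for a constant factor is applied at each x, to a function
   on a one-point type. *)
have := @ge0_funeposM unit R (w x) (fun=> f x) (w0 x).
by move=> /(congr1 (fun g => g tt)); rewrite !funeposE.
Qed.

Lemma funeneg_scaled T (w : T -> R) (f : T -> \bar R) : (forall x, 0 <= w x)%R ->
  (fun x => (w x)%:E * f x)^\- = (fun x => (w x)%:E * f^\- x).
Proof.
move=> w0; apply/funext => x.
have := @ge0_funenegM unit R (w x) (fun=> f x) (w0 x).
by move=> /(congr1 (fun g => g tt)); rewrite !funenegE.
Qed.

Lemma integral_mrestr d (T : measurableType d) (mu : {measure set T -> \bar R})
    (D : set T) (mD : measurable D) (f : T -> \bar R) :
  \int[mrestr mu mD]_x f x = \int[mu]_(x in D) f x.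
Proof.
transitivity (\int[mrestr mu mD]_(x in D) f x).
  rewrite [RHS]integral_mkcond; apply: (eq_integral_off_null _ (~` D)).
  - exact: measurableC.
  - by rewrite /= /mrestr setICl measure0.
  - by move=> x /contrapT Dx; rewrite patchE mem_set.
apply: eq_measure_integral => A mA AD /=.
by rewrite /mrestr setIidl.
Qed.

End ereal_parts.

(** * Surface integrals as slices of the polar formula *)

Section polar_theory.
Context {R : realType} (m : nat).
Hypothesis m_gt0 : (0 < m)%N.

Local Notation L := (lebesgue_rV R m).
Local Notation la := (@lebesgue_measure R).
Local Notation weight := (@polar_weight R m).
Local Notation RV := (measurableTypeR R * 'rV[R]_m)%type.

Lemma measurable_sphere (r : R) : measurable (sphere m r).
Proof.
rewrite (_ : sphere m r = @enorm R m @^-1` [set r]); last by [].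
by rewrite -[X in measurable X]setTI; exact: measurable_enorm.
Qed.

Lemma enorm_sphere_proj (r : R) (x : 'rV[R]_m) : 0 <= r -> x != 0 ->
  enorm (sphere_proj r x) = r.
Proof.
move=> r0 x0; have xp : enorm x != 0 by rewrite enorm_eq0.
by rewrite enormZ normrM normfV !ger0_norm ?enorm_ge0// divfK.
Qed.

(** The origin is sent to itself, off the sphere; so the preimage of the sphere misses exactly one
    point, a null set. *)
Lemma sphere_projP (r : R) : 0 < r -> forall x : 'rV[R]_m,
  (x != 0) = (sphere_proj r x \in sphere m r).
Proof.
move=> r0 x; have [->|x0] := eqVneq x 0.
  rewrite /sphere_proj scaler0; apply/esym/negbTE/negP; rewrite inE /sphere /= enorm0.
  by move=> r0'; rewrite -r0' ltxx in r0.
by rewrite mem_set// /sphere /= enorm_sphere_proj// ltW.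
Qed.

Lemma ge0_integral_surface (phi : 'rV[R]_m -> \bar R) (r : R) : 0 < r ->
  measurable_fun setT phi -> (forall x, 0 <= phi x)%E ->
  (\int[surface_measure m r]_(v in sphere m r) phi v =
   \int[L]_x ((weight (r, x))%:E * phi (sphere_proj r x)))%E.
Proof.
move=> r0 mphi phi0.
have mS := measurable_sphere r.
have mB : measurable (@unit_ball R m) := @measurable_unit_ball R m.
have mp := @measurable_sphere_proj R m r.
pose P : {measure set 'rV[R]_m -> \bar R} :=
  measure_function_pushforward__canonical__measure_function_Measure
    (mrestr L (@measurable_unit_ball R m)) mp.
have k0 : 0 <= m%:R * `|r| ^+ m.-1 by rewrite mulr_ge0// exprn_ge0.
transitivity (\int[mscale (NngNum k0) P]_(v in sphere m r) phi v)%E; first by [].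
rewrite ge0_integral_mscale//; last exact: measurable_funTS.
rewrite ge0_integral_pushforward//; last exact: measurable_funTS.
rewrite integral_mkcond integral_mrestr -ge0_integralZl//; last 2 first.
- apply: measurable_funTS; apply/(measurable_restrictT _ _).1.
    by rewrite -[X in measurable X]setTI; exact: (@measurable_sphere_proj R m r).
  by apply: measurable_funTS; exact: (measurableT_comp mphi mp).
- by move=> x _; rewrite patchE; case: ifP => // _; exact: phi0.
rewrite integral_mkcond; apply: (eq_integral_off_null _ [set (0 : 'rV[R]_m)]).
- exact: measurable_origin.
- exact: lebesgue_rV_origin.
move=> x /eqP x0; rewrite !patchE /polar_weight /= r0 mul1r.
have -> : (x \in sphere_proj r @^-1` sphere m r) = true.
  by rewrite -x0 (sphere_projP _ r0); apply/idP/idP; rewrite !inE.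
rewrite mem_unit_ball.
case: (enorm x <= 1) => /=; last by rewrite mul0r mul0e.
by rewrite mul1r (gtr0_norm r0).
Qed.

Lemma integral_surface (phi : 'rV[R]_m -> \bar R) (r : R) : 0 < r ->
  measurable_fun setT phi ->
  (\int[surface_measure m r]_(v in sphere m r) phi v =
   \int[L]_x ((weight (r, x))%:E * phi (sphere_proj r x)))%E.
Proof.
move=> r0 mphi; rewrite integralE [RHS]integralE.
rewrite funepos_scaled; last by move=> x; exact: polar_weight_ge0.
rewrite funeneg_scaled; last by move=> x; exact: polar_weight_ge0.
rewrite !ge0_integral_surface//; [|exact: measurable_funeneg|exact: measurable_funepos].
by congr (_ - _)%E; apply: eq_integral => x _; rewrite ?funeposE ?funenegE.
Qed.

(** By polar coordinates the volume of [N] is the integral over r of the areas of its spherical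
    slices; a nonnegative function of zero integral vanishes almost everywhere. *)
Lemma ae_surface_null (N : set 'rV[R]_m) : measurable N -> L N = 0%E ->
  {ae la, forall r, 0 < r -> surface_measure m r (N `&` sphere m r) = 0%E}.
Proof.
move=> mN N0.
pose phi x : \bar R := (\1_N x)%:E.
have mphi : measurable_fun setT phi by exact/measurable_EFinP.
have phi0 x : (0 <= phi x)%E by rewrite lee_fin.
have := ge0_integral_polar _ m_gt0 _ mphi phi0.
rewrite integral_indic// setIT [X in X = _ -> _]N0.
have mpolar : measurable_fun setT
    (fun z : RV => (weight z)%:E * phi (sphere_proj z.1 z.2))%E.
  apply: emeasurable_funM; first by apply/measurable_EFinP; exact: measurable_polar_weight.
  exact: (measurableT_comp mphi (@measurable_sphere_proj2 R m)).
have polar0 z : (0 <= (weight z)%:E * phi (sphere_proj z.1 z.2))%E.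
  by rewrite mule_ge0// lee_fin polar_weight_ge0.
rewrite (fubini_tonelli1 _ mpolar polar0) => /esym F0.
have mF := measurable_fun_fubini_tonelli_F (m2 := L) _ mpolar polar0.
have : ae_eq la setT (fubini_F L (fun z : RV =>
    (weight z)%:E * phi (sphere_proj z.1 z.2))%E) (cst 0%E).
  apply/(ae_eq_integral_abs la measurableT mF); rewrite -[RHS]F0.
  apply: eq_integral => r _; rewrite gee0_abs//.
  by apply: integral_ge0 => x _; exact: polar0.
apply: filterS => r /(_ Logic.I) Fr r0; move: Fr.
rewrite /fubini_F /= -ge0_integral_surface// integral_indic//.
exact: measurable_sphere.
Qed.

(* For r > 0 this is the integral of phi over the sphere of radius r, by
   [integral_surface]; for r <= 0 it is 0. *)
Definition spherical_integral (phi : 'rV[R]_m -> R) (r : R) : R :=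
  \int[L]_x (weight (r, x) * phi (sphere_proj r x)).

Let measurable_polar (phi : 'rV[R]_m -> R) : measurable_fun setT phi ->
  measurable_fun setT (fun z : RV => weight z * phi (sphere_proj z.1 z.2)).
Proof.
move=> mphi; apply: measurable_funM; first exact: measurable_polar_weight.
exact: (measurableT_comp mphi (@measurable_sphere_proj2 R m)).
Qed.

Let integrable_polar (phi : 'rV[R]_m -> R) : L.-integrable setT (EFin \o phi) ->
  (la \x L)%E.-integrable setT (fun z : RV => (weight z * phi (sphere_proj z.1 z.2))%:E).
Proof.
move=> /integrableP[mphi phioo]; apply/integrableP; split.
  by apply/measurable_EFinP; apply: measurable_polar; apply/measurable_EFinP.
have -> : (\int[la \x L]_z `|(weight z * phi (sphere_proj z.1 z.2))%:E|)%E =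
    (\int[L]_x `|(phi x)%:E|)%E.
  rewrite (ge0_integral_polar _ m_gt0 (fun x => `|(phi x)%:E|)%E)//; last first.
    exact: measurableT_comp.
  apply: eq_integral => z _ /=.
  by rewrite normrM ger0_norm ?polar_weight_ge0// EFinM.
exact: phioo.
Qed.

Lemma integral_polar (phi : 'rV[R]_m -> R) : L.-integrable setT (EFin \o phi) ->
  (\int[L]_y (phi y)%:E =
    \int[la]_r \int[L]_x (weight (r, x) * phi (sphere_proj r x))%:E)%E.
Proof.
move=> iphi; have := integrable_polar _ iphi => ip.
have /measurable_EFinP mphi := measurable_int _ iphi.
rewrite (integral12_prod_meas1 ip) integralE [RHS]integralE.
have -> : (fun z : RV => (weight z * phi (sphere_proj z.1 z.2))%:E) =
  (fun z : RV => (weight z)%:E * (phi (sphere_proj z.1 z.2))%:E)%E.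
  by apply/funext => z; rewrite EFinM.
rewrite funepos_scaled; last by move=> x; exact: polar_weight_ge0.
rewrite funeneg_scaled; last by move=> x; exact: polar_weight_ge0.
have mE : measurable_fun setT (fun y => (phi y)%:E) by exact/measurable_EFinP.
rewrite (ge0_integral_polar _ m_gt0 _ (measurable_funepos mE))//.
rewrite (ge0_integral_polar _ m_gt0 _ (measurable_funeneg mE))//.
by congr (_ - _)%E; apply: eq_integral => z _; rewrite ?funeposE ?funenegE.
Qed.

Lemma integrable_integral_polar (phi : 'rV[R]_m -> R) : L.-integrable setT (EFin \o phi) ->
  la.-integrable setT
    (fun r => \int[L]_x (weight (r, x) * phi (sphere_proj r x))%:E)%E.
Proof. by move=> /integrable_polar/integrable_fubini_F. Qed.

End polar_theory.

(** * Radial kernels and first moments *)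

Section radial_kernels.
Context {R : realType} (m : nat).
Hypothesis m_gt0 : (0 < m)%N.

Local Notation L := (lebesgue_rV R m).
Local Notation la := (@lebesgue_measure R).
Local Notation weight := (@polar_weight R m).
Local Notation RV := (measurableTypeR R * 'rV[R]_m)%type.

(** For t = h^2, the exponent b = (m+1)/2 gives Poisson's kernel up to a factor, and b = (m+3)/2 the
    radial factor of its gradient. *)
Definition radial_kernel (b t : R) (y : 'rV[R]_m) : R :=
  (enorm y ^+ 2 + t) `^ (- b).

Lemma measurable_radial_kernel b t : measurable_fun setT (radial_kernel b t).
Proof.
apply: (measurableT_comp (measurable_powR _)); apply: measurable_funD => //.
by apply: measurable_funX; exact: measurable_enorm.
Qed.

Lemma radial_kernel_ge0 b t y : 0 <= radial_kernel b t y.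
Proof. exact: powR_ge0. Qed.

Lemma sqr_enormD_gt0 (t : R) (y : 'rV[R]_m) : 0 < t -> 0 < enorm y ^+ 2 + t.
Proof. by move=> t0; rewrite ltr_wpDl// exprn_ge0// enorm_ge0. Qed.

Lemma radial_kernelD b c t y : 0 < t ->
  radial_kernel (b + c) t y = radial_kernel b t y * radial_kernel c t y.
Proof.
move=> t0; have n0 : enorm y ^+ 2 + t != 0 by rewrite gt_eqF ?sqr_enormD_gt0.
by rewrite /radial_kernel opprD powRD// n0 implybT.
Qed.

Lemma radial_kernel_le b t y : 0 <= b -> 0 < t -> radial_kernel b t y <= t `^ (- b).
Proof.
move=> b0 t0; have u0 := sqr_enormD_gt0 _ y t0.
rewrite /radial_kernel !powRN lef_pV2 ?posrE ?powR_gt0//.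
by apply: ge0_ler_powR; rewrite ?nnegrE ?(ltW t0) ?(ltW u0)// lerDr exprn_ge0// enorm_ge0.
Qed.

(** Half a unit of exponent pays for one coordinate: the first moment with exponent (m+3)/2 is
    dominated by the kernel of exponent (m+2)/2, which is integrable. *)
Lemma radial_kernel_half_le t (y : 'rV[R]_m) i : 0 < t ->
  radial_kernel 2^-1 t y * `|y ord0 i| <= 1.
Proof.
move=> t0; have u0 := sqr_enormD_gt0 _ y t0.
rewrite /radial_kernel powRN powR12_sqrt ?(ltW u0)// mulrC ler_pdivrMr ?sqrtr_gt0//.
rewrite mul1r (le_trans (coord_le_enorm _ _ _))//.
by rewrite -[leLHS]ger0_norm ?enorm_ge0// -sqrtr_sqr ler_wsqrtr// lerDl ltW.
Qed.

Let a : R := m.+1%:R / 2.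

Lemma integrable_radial_kernel t : 0 < t ->
  L.-integrable setT (EFin \o radial_kernel a t).
Proof.
move=> t0; apply/integrableP; split.
  by apply/measurable_EFinP; exact: measurable_radial_kernel.
have mK : measurable_fun setT (fun y => (radial_kernel a t y)%:E).
  by apply/measurable_EFinP; exact: measurable_radial_kernel.
have K0 y : (0 <= (radial_kernel a t y)%:E)%E by rewrite lee_fin radial_kernel_ge0.
under eq_integral do rewrite gee0_abs ?K0//.
rewrite (ge0_integral_polar _ m_gt0 _ mK K0).
have mpolar : measurable_fun setT
    (fun z : RV => (weight z)%:E * (radial_kernel a t (sphere_proj z.1 z.2))%:E)%E.
  apply: emeasurable_funM; first by apply/measurable_EFinP; exact: measurable_polar_weight.
  exact: (measurableT_comp mK (@measurable_sphere_proj2 R m)).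
have polar0 z : (0 <= (weight z)%:E * (radial_kernel a t (sphere_proj z.1 z.2))%:E)%E.
  by rewrite mule_ge0// lee_fin polar_weight_ge0.
rewrite (fubini_tonelli1 _ mpolar polar0).
have mO : measurable_fun setT (fun r : R => (oneDsqr r)^-1).
  exact: (continuous_measurable_fun (@continuous_oneDsqrV R)).
pose B := fine (L (@unit_ball R m)).
have B0 : 0 <= B by exact: fine_ge0.
(* m [B] is the area of the unit sphere, and the maximum comes from 1 + r^2 <= max(1, 1/t) (r^2 +
   t). *)
pose C := m%:R * B * Num.max 1 t^-1.
have C0 : 0 <= C by rewrite !mulr_ge0// le_max ler01.
pose bound (r : R) : \bar R := (C * (0 <= r)%R%:R * (oneDsqr r)^-1)%:E.
have bound0 r : (0 <= bound r)%E.
  rewrite lee_fin; apply: mulr_ge0; first exact: mulr_ge0.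
  by rewrite invr_ge0 (le_trans _ (oneDsqr_ge1 _)).
apply: (@le_lt_trans _ _ (\int[la]_r bound r)%E); last first.
  rewrite (_ : (fun r => bound r) =
      fun r => (C%:E * ((fun r : R => ((oneDsqr r)^-1)%:E) \_ `[0%R, +oo[) r)%E).
    rewrite ge0_integralZl//; last 2 first.
    - apply/(measurable_restrictT _ _).1 => //; apply: measurable_funTS.
      by apply/measurable_EFinP; exact: mO.
    - by move=> x _; rewrite patchE; case: ifP.
    by rewrite -integral_mkcond integral0y_oneDsqr -EFinM ltry.
  apply/funext => r; rewrite patchE mem_setE in_itv/= andbT /bound.
  by case: ifP => _; rewrite ?mulr1 ?mulr0 ?mul0r ?mule0// EFinM.
apply: ge0_le_integral => //.
- by move=> r _; apply: integral_ge0 => x _; exact: polar0.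
- exact: (measurable_fun_fubini_tonelli_F (m2 := L) _ mpolar polar0).
- apply/measurable_EFinP; apply: measurable_funM.
    apply: measurable_funM => //; apply: measurable_natr_bool.
    exact: measurable_fun_ler.
  exact: mO.
suff key (r : R) : (\int[L]_x ((weight (r, x))%:E *
    (radial_kernel a t (sphere_proj r x))%:E) <= bound r)%E by move=> r _; exact: key.
have [r0|r0] := ltP 0 r; last first.
  rewrite integral0_eq; last by move=> x _; rewrite /polar_weight/= ltNge r0/= !mul0r mul0e.
  exact: bound0.
pose k := m%:R * r ^+ m.-1 * (r ^+ 2 + t) `^ (- a).
rewrite (eq_integral_off_null _ [set (0 : 'rV[R]_m)] _
    (fun x => (k * \1_(@unit_ball R m) x)%:E)); last 3 first.
- exact: measurable_origin.
- exact: lebesgue_rV_origin.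
- move=> x /eqP x0; rewrite -EFinM /radial_kernel enorm_sphere_proj//=; last exact: ltW.
  rewrite /polar_weight/= r0 indicE.
  rewrite mem_unit_ball.
  by rewrite mul1r /k; congr EFin; ring.
have rt0 : 0 < r ^+ 2 + t by rewrite ltr_wpDl// exprn_ge0// ltW.
have k0 : 0 <= k by rewrite !mulr_ge0 ?powR_ge0// exprn_ge0// ltW.
under eq_integral do rewrite EFinM.
have mB := @measurable_unit_ball R m.
rewrite ge0_integralZl//; last exact/measurable_EFinP.
rewrite integral_indic// setIT -[X in (_ * X)%E](@fineK _ (L (@unit_ball R m))); last first.
  by rewrite ge0_fin_numE//; exact: lebesgue_rV_unit_ball_lty.
rewrite /bound -EFinM lee_fin (ltW r0)/= mulr1 /k /C -/B.
have mB0 : 0 <= m%:R * B by rewrite mulr_ge0.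
rewrite -[leRHS]mulrA.
have -> : m%:R * r ^+ m.-1 * (r ^+ 2 + t) `^ (- a) * B =
  m%:R * B * (r ^+ m.-1 * (r ^+ 2 + t) `^ (- a)) by ring.
rewrite ler_wpM2l//.
apply: (@le_trans _ _ ((r ^+ 2 + t)^-1)).
  (* The power (m-1)/2 of r^2 + t outweighs r^(m-1), which leaves 1/(r^2 + t). *)
  have -> : - a = - (m.-1%:R / 2) - 1 by rewrite /a -[in m.+1](prednK m_gt0) -!natr1; field.
  rewrite powRD ?(gt_eqF rt0) ?implybT// powR_inv1 ?(ltW rt0)// mulrA.
  rewrite ler_piMl ?invr_ge0 ?(ltW rt0)//.
  rewrite powRN ler_pdivrMr ?powR_gt0// mul1r.
  rewrite mulrC powRrM powR12_sqrt ?(ltW rt0)// powR_mulrn ?sqrtr_ge0//.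
  rewrite lerXn2r ?nnegrE ?sqrtr_ge0 ?(ltW r0)//.
  by rewrite -[leLHS]gtr0_norm// -sqrtr_sqr ler_wsqrtr// lerDl ltW.
rewrite -[leRHS]mulrC ler_pdivlMl; last by rewrite (lt_le_trans _ (oneDsqr_ge1 _)).
rewrite ler_pdivrMr// /oneDsqr.
have : 1 <= Num.max 1 t^-1 by rewrite le_max lexx.
have : t^-1 <= Num.max 1 t^-1 by rewrite le_max lexx orbT.
set M := Num.max _ _; rewrite -(ler_pM2r t0) mulVf ?gt_eqF// => h1.
move=> /(ler_wpM2r (exprn_ge0 2 (ltW r0))); lra.
Qed.

Lemma integrable_radial_kernel_ge b t : a <= b -> 0 < t ->
  L.-integrable setT (EFin \o radial_kernel b t).
Proof.
move=> ab t0.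
apply: (le_integrable_EFin _ _ _ (fun y => t `^ (- (b - a)) * radial_kernel a t y)) => //.
- exact: measurable_radial_kernel.
- move=> y _; rewrite ger0_norm ?radial_kernel_ge0//.
  rewrite -[in leLHS](subrK a b) radial_kernelD// ler_wpM2r ?radial_kernel_ge0//.
  by rewrite radial_kernel_le// subr_ge0.
- by have := integrableZl measurableT (t `^ (- (b - a))) (integrable_radial_kernel _ t0).
Qed.

End radial_kernels.

Lemma integrable_indic_unit_ball {R : realType} m :
  (lebesgue_rV R m).-integrable setT (EFin \o \1_(@unit_ball R m)).
Proof.
have mB := @measurable_unit_ball R m.
apply/integrableP; split; first exact/measurable_EFinP.
under eq_integral do rewrite /= ger0_norm//.
by rewrite integral_indic// setIT; exact: lebesgue_rV_unit_ball_lty.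
Qed.

Section spherical_moments.
Context {R : realType} (m : nat).
Hypothesis m_gt0 : (0 < m)%N.

Local Notation L := (lebesgue_rV R m).
Local Notation la := (@lebesgue_measure R).
Local Notation weight := (@polar_weight R m).
Local Notation RV := (measurableTypeR R * 'rV[R]_m)%type.

Variables (g : 'rV[R]_m -> R) (M : R) (i : 'I_m).
Hypothesis mg : measurable_fun setT g.
Hypothesis gM : forall x, `|g x| <= M.

Let gi v := g v * v ord0 i.
Let s : R := m.+1%:R / 2 + 1.
Let J := spherical_integral m gi.

Let mgi : measurable_fun setT gi.
Proof. by apply: measurable_funM => //; exact: measurable_coord. Qed.

Let M_ge0 : 0 <= M. Proof. by apply: le_trans (gM 0). Qed.

Let s_gt0 : 0 < s. Proof. by rewrite addr_gt0// divr_gt0. Qed.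

Lemma integrable_first_moment t : 0 < t ->
  L.-integrable setT (EFin \o (fun y => radial_kernel m s t y * gi y)).
Proof.
move=> t0.
apply: (le_integrable_EFin _ _ _ (fun y => M * radial_kernel m (m.+1%:R / 2 + 2^-1) t y)) => //.
- by apply: measurable_funM => //; exact: measurable_radial_kernel.
- move=> y _; rewrite /gi mulrCA normrM ler_pM//.
  have -> : s = m.+1%:R / 2 + 2^-1 + 2^-1 by rewrite /s; lra.
  rewrite normrM ger0_norm ?radial_kernel_ge0// radial_kernelD// -mulrA.
  by rewrite ler_piMr ?radial_kernel_ge0// radial_kernel_half_le.
- have ik := integrable_radial_kernel_ge m m_gt0 (m.+1%:R / 2 + 2^-1) t.
  have /(_ _ t0) {}ik := ik; have := integrableZl measurableT M (ik _).
  by apply; rewrite lerDl.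
Qed.

Let integrable_slice r :
  L.-integrable setT (EFin \o (fun x => weight (r, x) * gi (sphere_proj r x))).
Proof.
have [r0|r0] := ltP 0 r; last first.
  apply: (eq_integrable _ (cst 0%E)) => //; last exact: integrable0.
  by move=> x _ /=; rewrite /polar_weight/= ltNge r0/= !mul0r.
pose k := m%:R * r ^+ m.-1 * (M * r).
have k0 : 0 <= k by rewrite !mulr_ge0// ?exprn_ge0// ltW.
have mB := @measurable_unit_ball R m.
apply: (le_integrable_EFin _ _ _ (fun x => k * \1_(@unit_ball R m) x)) => //.
- apply: measurable_funM.
    by apply: (measurableT_comp (@measurable_polar_weight R m)); exact: measurable_pair1.
  exact: (measurableT_comp mgi (@measurable_sphere_proj R m r)).
- move=> x _; rewrite normrM ger0_norm ?polar_weight_ge0//.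
  rewrite /polar_weight/= r0 mul1r indicE.
  rewrite mem_unit_ball.
  case: (enorm x <= 1); rewrite ?mul0r ?mulr0// mul1r mulr1 /k ler_wpM2l//.
    by rewrite mulr_ge0// exprn_ge0// ltW.
  rewrite normrM ler_pM// (le_trans (coord_le_enorm _ _ _))//.
  have [->|x0] := eqVneq x 0; first by rewrite /sphere_proj scaler0 enorm0 ltW.
  by rewrite enorm_sphere_proj// ltW.
- have := integrableZl measurableT k (integrable_indic_unit_ball m).
  exact.
Qed.

(** The radial kernel is constant on the sphere of radius r and leaves the integral; for r <= 0 the
    weight makes both sides 0. *)
Let integral_slice r t :
  (\int[L]_x (weight (r, x) *
     (radial_kernel m s t (sphere_proj r x) * gi (sphere_proj r x)))%:E =
   ((r ^+ 2 + t) `^ (- s) * J r)%:E)%E.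
Proof.
have iS := integrable_slice r.
rewrite EFinM /J /spherical_integral /Rintegral fineK; last first.
  exact: (integrable_fin_num measurableT iS).
rewrite -(integralZl measurableT iS).
apply: (eq_integral_off_null _ [set (0 : 'rV[R]_m)]).
- exact: measurable_origin.
- exact: lebesgue_rV_origin.
move=> x /eqP x0; rewrite -EFinM; congr EFin.
have [r0|r0] := ltP 0 r; last by rewrite /polar_weight/= ltNge r0/= !mul0r mulr0.
by rewrite /radial_kernel enorm_sphere_proj// ?(ltW r0)// mulrCA.
Qed.

(** This exhibits the first moment as a Stieltjes transform of [J], with weight r^2. *)
Let polar_moment t : 0 < t ->
  la.-integrable setT (EFin \o (fun r => (r ^+ 2 + t) `^ (- s) * J r)) /\
  \int[la]_r ((r ^+ 2 + t) `^ (- s) * J r) = \int[L]_y (radial_kernel m s t y * gi y).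
Proof.
move=> t0; have iM := integrable_first_moment _ t0; split.
  have := integrable_integral_polar m m_gt0 _ iM.
  by apply: eq_integrable => // r _ /=; rewrite integral_slice.
rewrite /Rintegral (integral_polar m m_gt0 _ iM).
by congr fine; apply: eq_integral => r _; rewrite integral_slice.
Qed.

(** Fubini gives the measurability of [J] times a kernel; the kernel is positive and can be divided
    out. *)
Let measurable_J : measurable_fun setT J.
Proof.
have [/measurable_int /measurable_EFinP mS _] := polar_moment _ ltr01.
rewrite (_ : J = fun r => (r ^+ 2 + 1) `^ s * ((r ^+ 2 + 1) `^ (- s) * J r)).
  apply: measurable_funM => //; apply: (measurableT_comp (measurable_powR _)).
  by apply: measurable_funD => //; exact: measurable_funX.
apply/funext => r; have n0 : r ^+ 2 + 1 != 0 by rewrite gt_eqF// ltr_wpDl// sqr_ge0.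
by rewrite mulrA -powRD ?n0 ?implybT// addrN powRr0 mul1r.
Qed.

Let J_le0 r : r <= 0 -> J r = 0.
Proof.
move=> r0; rewrite /J /spherical_integral /Rintegral integral0_eq// => x _.
by rewrite /polar_weight/= ltNge r0/= !mul0r.
Qed.

Lemma moment_eq0_of_ae : {ae la, forall r, 0 < r -> J r = 0} ->
  forall t, 0 < t -> \int[L]_y (radial_kernel m s t y * gi y) = 0.
Proof.
move=> J0 t t0; have [_ <-] := polar_moment _ t0.
have [N [mN N0 sN]] := J0.
rewrite /Rintegral (eq_integral_off_null _ N _ (cst 0%E))//; first by rewrite integral0.
move=> r Nr; have [r0|r0] := ltP 0 r; last by rewrite J_le0// mulr0.
suff -> : J r = 0 by rewrite mulr0.
by apply: contrapT => Jr; apply: Nr; apply: sN => /= /(_ r0).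
Qed.

(** The tails over r^2 > rho vanish by [stieltjes_tail_eq0], each level set of r^2 having at most
    two points. As [J] is 0 on the negative half-line, this determines the primitive of [H]. *)
Lemma ae_eq0_of_moment :
  (forall t, 0 < t -> \int[L]_y (radial_kernel m s t y * gi y) = 0) ->
  {ae la, forall r, 0 < r -> J r = 0}.
Proof.
move=> mom0.
pose H r := (r ^+ 2 + 1) `^ (- s) * J r.
have [iH] := polar_moment _ ltr01; rewrite mom0// => H0.
have tail rho : 0 < rho -> \int[la]_(r in [set r | rho < r ^+ 2]) (H r) = 0.
  move=> rho0.
  apply: (stieltjes_tail_eq0 la (fun r => r ^+ 2) J s) => //.
  - by move=> r; exact: sqr_ge0.
  - by move=> t t0; have [? ->] := polar_moment _ t0; rewrite mom0.
  - rewrite (_ : _ @^-1` _ = [set Num.sqrt rho; - Num.sqrt rho]).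
      apply: countable_lebesgue_measure0; apply: finite_set_countable; exact: finite_set2.
    apply/seteqP; split => r /=.
      move=> r2; have : r ^+ 2 == Num.sqrt rho ^+ 2 by rewrite sqr_sqrtr ?(ltW rho0)//; apply/eqP.
      by rewrite eqf_sqr => /orP[] /eqP; [left|right].
    by case=> ->; rewrite ?sqrrN sqr_sqrtr// ltW.
(* For x > 0 this is the total integral, which is the moment at t = 1 and hence 0, minus a tail. *)
have prim x : \int[la]_(r in `]-oo, x]) (H r) = 0.
  have [x0|x0] := leP x 0.
    rewrite /Rintegral integral0_eq// => r /=; rewrite in_itv/= => rx.
    by rewrite /H J_le0 ?mulr0// (le_trans rx).
  have : \int[la]_(r in `]-oo, x] `|` `]x, +oo[) (H r) = 0.
    by rewrite itv_setU_setT.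
  rewrite Rintegral_setU//; last 2 first.
  - by rewrite itv_setU_setT.
  - by apply/disj_setPS => r []/=; rewrite !in_itv/= andbT => /le_lt_trans/[apply]; rewrite ltxx.
  have -> : \int[la]_(r in `]x, +oo[) H r = 0; last by rewrite addr0.
  rewrite -(tail (x ^+ 2)) ?exprn_gt0// Rintegral_mkcond [RHS]Rintegral_mkcond.
  suff -> : H \_ `]x, +oo[ = H \_ [set r | x ^+ 2 < r ^+ 2] by [].
  apply/funext => r; rewrite !patchE.
  (* The condition on squares also admits r < - x, where [H] is 0. *)
  have [r0|r0] := ltP 0 r; last by rewrite /H J_le0// mulr0; case: ifP; case: ifP.
  congr (if _ then _ else _); apply/idP/idP; rewrite !inE/= in_itv/= andbT;
    by rewrite ltr_pXn2r ?nnegrE ?(ltW x0) ?(ltW r0).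
(* Lebesgue differentiation: almost everywhere [H] is the derivative of its primitive, which is
   identically 0. *)
have := @FTC1Ny R H; case.
- by move=> y; exact: integrableS iH.
- by apply: open_integrable_locally => //; exact: openT.
move=> N [mN N0 sN]; exists N; split => // r /= nJ; apply: sN => /= -[_].
rewrite (_ : (fun y => _) = cst 0); last by apply/funext.
rewrite derive1_cst => /esym/eqP; rewrite mulf_eq0 gt_eqF/=; last first.
  by rewrite powR_gt0// ltr_wpDl// sqr_ge0.
by move=> /eqP Jr; apply: nJ.
Qed.

End spherical_moments.

(** * The gradient of the Poisson integral *)

Section frechet.
Context {R : realType} {m : nat}.

Definition dot_rV (c x : 'rV[R]_m) : R := \sum_(i < m) x ord0 i * c ord0 i.

Lemma dot_rV_is_linear c : linear (dot_rV c : 'rV[R]_m -> R^o).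
Proof.
move=> k x y; rewrite /dot_rV scaler_sumr -big_split; apply: eq_bigr => i _ /=.
by rewrite !mxE mulrDl -mulrA.
Qed.

HB.instance Definition _ c :=
  GRing.isLinear.Build R 'rV[R]_m R^o _ (dot_rV c) (dot_rV_is_linear c).

Lemma dot_rV_continuous c : continuous (dot_rV c).
Proof.
rewrite /dot_rV; elim: (index_enum _) => [|i r IH] x.
  rewrite (_ : (fun _ => _) = cst 0); last by apply/funext => y; rewrite big_nil.
  exact: cst_continuous.
rewrite (_ : (fun _ => _) = (fun y : 'rV[R]_m => y ord0 i * c ord0 i) \+
    (fun y => \sum_(j <- r) y ord0 j * c ord0 j)); last first.
  by apply/funext => y; rewrite big_cons.
apply: continuousD; last exact: IH.
by apply: continuousM; [exact: coord_continuous|exact: cst_continuous].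
Qed.

Lemma dot_rV_delta c i : dot_rV c (delta_mx ord0 i) = c ord0 i.
Proof.
rewrite /dot_rV (bigD1 i)//= mxE !eqxx mul1r big1 ?addr0// => j ji.
by rewrite mxE eqxx (negbTE ji) mul0r.
Qed.

End frechet.

Lemma differentiable_quadratic_remainder {R : realType} (V W : normedModType R)
    (u : V -> W) (df : {linear V -> W}) (C e : R) : continuous df -> 0 < e ->
  (forall x, `|x| <= e -> `|u x - u 0 - df x| <= C * `|x| ^+ 2) ->
  differentiable u 0 /\ 'd u 0 = df :> (V -> W).
Proof.
move=> cdf e0 uC.
(* No sign is assumed of [C]; [D] is positive, so the radius eps / D is meaningful. *)
pose D := `|C| + 1; have D0 : 0 < D by rewrite ltr_wpDl.
have uo : u \o shift 0 = cst (u 0) + df +o_ 0 id.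
  apply/eqaddoP => eps eps0; near=> x.
  rewrite /= -[X in `|X|]/(u (x + 0) - (u 0 + df x)) addr0 opprD addrA.
  have xe : `|x| <= e by near: x; exact: nbhs0_le.
  apply: le_trans (uC _ xe) _.
  apply: (@le_trans _ _ (D * `|x| ^+ 2)).
    by rewrite ler_wpM2r ?exprn_ge0// (le_trans (ler_norm C))// lerDl.
  rewrite expr2 mulrA ler_wpM2r// mulrC -ler_pdivlMr//.
  by near: x; apply: nbhs0_le; exact: divr_gt0.
have dE := diff_unique cdf uo.
by split => //; apply/diff_locallyP; rewrite dE.
Unshelve. all: by end_near. Qed.

Lemma gradient_quadratic_remainder {R : realType} (m : nat)
    (u : 'rV[R]_m -> R) (c : 'rV[R]_m) (C e : R) : 0 < e ->
  (forall x, `|x| <= e -> `|u x - u 0 - dot_rV c x| <= C * `|x| ^+ 2) ->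
  differentiable u 0 /\ gradient u 0 = c.
Proof.
move=> e0 uC.
have [du dE] := @differentiable_quadratic_remainder R 'rV[R]_m R^o u (dot_rV c)
  C e (dot_rV_continuous c) e0 uC.
split => //; apply/rowP => i; rewrite mxE deriveE// dE.
exact: dot_rV_delta.
Qed.



Section poisson_gradient.
Context {R : realType} (m : nat).
Hypothesis m_gt0 : (0 < m)%N.

Local Notation L := (lebesgue_rV R m).

(** The area is m + 1 times the volume of the unit ball of dimension m + 1. Finiteness counts as
    much as positivity, since [fine] sends an infinite value to 0. *)
Lemma sphere_area_gt0 : 0 < sphere_area R m.
Proof.
rewrite /sphere_area; set S := sphere m.+1 1.
have mS : measurable S := @measurable_sphere R m.+1 1.
have -> : surface_measure m.+1 (1 : R) S =
    (m.+1%:R%:E * lebesgue_rV R m.+1 (@unit_ball R m.+1))%E.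
  have mB := @measurable_unit_ball R m.+1.
  transitivity (\int[surface_measure m.+1 1]_(v in S) (cst 1%E v))%E.
    by rewrite integral_cst// mul1e.
  rewrite (ge0_integral_surface m.+1 isT)//.
  under eq_integral => x _.
    rewrite mule1 /polar_weight/= ltr01 mul1r expr1n mulr1 mulrC EFinM.
    have -> : (enorm x <= 1)%R%:R = \1_(@unit_ball R m.+1) x :> R.
      by rewrite indicE mem_unit_ball.
    over.
  by rewrite ge0_integralZl// ?integral_indic ?setIT//; exact/measurable_EFinP.
have Boo := lebesgue_rV_unit_ball_lty (R := R) m.+1.
have B0 := lebesgue_rV_unit_ball_gt0 (R := R) m.+1.
rewrite fine_gt0// mule_gt0// lte_mul_pinfty// ?lee_fin//.
Qed.

Variables (g : 'rV[R]_m -> R) (M : R).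
Hypothesis mg : measurable_fun setT g.
Hypothesis gM : forall x, `|g x| <= M.

Let M_ge0 : 0 <= M. Proof. by apply: le_trans (gM 0). Qed.

Variable h : R.
Hypothesis h_gt0 : 0 < h.

Let a : R := m.+1%:R / 2.
Let t := h ^+ 2.
Let k := 2 / sphere_area R m * h.
Let K b y := radial_kernel m b t y.

Let a0 : 0 < a. Proof. by rewrite divr_gt0. Qed.
Let t0 : 0 < t. Proof. by rewrite exprn_gt0. Qed.
Let k0 : 0 < k. Proof. by rewrite mulr_gt0// divr_gt0// sphere_area_gt0. Qed.

Let kernelE z : poisson_kernel z h = k * K a z.
Proof. by rewrite /poisson_kernel mulrA /K /radial_kernel powRN. Qed.

Let sqr_enormB (x y : 'rV[R]_m) :
  enorm (x - y) ^+ 2 = enorm y ^+ 2 + (enorm x ^+ 2 - 2 * dot_rV y x).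
Proof.
rewrite !sqr_enorm /dot_rV mulr_sumr -sumrB -big_split; apply: eq_bigr => i _ /=.
by rewrite !mxE; ring.
Qed.

(** The shift x is measured in the sup norm, which governs differentiability here, and y in the
    Euclidean norm of the kernel. *)
Let dot_le (x y : 'rV[R]_m) : `|dot_rV y x| <= m%:R * `|x| * enorm y.
Proof.
rewrite (le_trans (ler_norm_sum _ _ _))// -mulrA mulr_natl -[X in _ *+ X]card_ord.
rewrite -sumr_const ler_sum// => i _; rewrite normrM ler_pM//.
  exact: coord_le_norm.
exact: coord_le_enorm.
Qed.

(** For |x| <= e one gets (2m + 1)|x| <= 3h/8, which keeps the increment d of [shift_bound] within
    half of u. *)
Let e : R := h / (8 * m%:R).
Let m0 : 0 < m%:R :> R. Proof. by rewrite ltr0n. Qed.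
Let e0 : 0 < e. Proof. by rewrite divr_gt0// mulr_gt0. Qed.

(** Both h and |y| are at most v, the square root of u, whence |d| <= (2m + 1)|x| v. The second
    bound trades d^2 for |x|^2 u, so that the Taylor remainder has exponent a + 1 and a constant
    free of y. *)
Let shift_bound (x y : 'rV[R]_m) : `|x| <= e ->
  let u := enorm y ^+ 2 + t in
  let d := enorm x ^+ 2 - 2 * dot_rV y x in
  `|d| <= u / 2 /\ d ^+ 2 <= (2 * m%:R + 1) ^+ 2 * `|x| ^+ 2 * u.
Proof.
move=> xe u d.
have u0 : 0 < u by exact: sqr_enormD_gt0.
pose v := Num.sqrt u.
have v0 : 0 < v by rewrite sqrtr_gt0.
have v2 : v ^+ 2 = u by rewrite sqr_sqrtr// ltW.
have hv : h <= v.
  by rewrite -[leLHS]gtr0_norm// -sqrtr_sqr ler_wsqrtr// lerDr exprn_ge0// enorm_ge0.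
have yv : enorm y <= v.
  by rewrite -[leLHS]ger0_norm ?enorm_ge0// -sqrtr_sqr ler_wsqrtr// lerDl ltW.
have mx : m%:R * `|x| <= v / 8.
  move: xe; rewrite /e ler_pdivlMr ?mulr_gt0// => xe.
  rewrite ler_pdivlMr//; apply: le_trans hv; lra.
have mx0 : 0 <= m%:R * `|x| by rewrite mulr_ge0// ltW.
have x8 : `|x| <= v / 8.
  apply: le_trans mx; rewrite ler_peMl// ler1n//.
have dd : `|d| <= (2 * m%:R + 1) * `|x| * v.
  rewrite /d (le_trans (ler_normB _ _))//.
  rewrite [X in X + _]ger0_norm ?exprn_ge0 ?enorm_ge0//.
  have h1 := enorm_le_norm _ x.
  have h2 : m%:R * `|x| ^+ 2 <= v * `|x|.
    rewrite expr2 mulrA ler_wpM2r//; apply: le_trans mx _; lra.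
  have h3 : `|2 * dot_rV y x| <= 2 * (m%:R * `|x| * v).
    rewrite normrM (ger0_norm (_ : 0 <= 2))// ler_wpM2l//.
    by rewrite (le_trans (dot_le _ _))// ler_wpM2l.
  lra.
split.
  apply: le_trans dd _; rewrite -v2 expr2 mulrAC.
  have : (2 * m%:R + 1) * `|x| <= v / 2 by lra.
  by move=> /(ler_wpM2r (ltW v0)); lra.
rewrite -real_normK ?num_real// -v2 -!exprMn lerXn2r// ?nnegrE//.
by rewrite !mulr_ge0// ?(ltW v0)// addr_ge0// mulr_ge0// ltW.
Qed.

(** [C0] is the constant of [powRN_taylor]. In [C1] it carries the factor of [shift_bound], and a m
    accounts for the |x|^2 contained in d, which is not part of the linear term. *)
Let C0 : R := a * ((a + 1) * 2 `^ (a + 2)).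
Let C1 : R := C0 * (2 * m%:R + 1) ^+ 2 + a * m%:R.

Let kernel_remainder (x y : 'rV[R]_m) : `|x| <= e ->
  `|K a (x - y) - K a y - 2 * a * dot_rV y x * K (a + 1) y| <=
  C1 * `|x| ^+ 2 * K (a + 1) y.
Proof.
move=> xe; have [d1 d2] := shift_bound _ y xe.
move: d1 d2; set u := _ + t; set d := _ - _ => d1 d2.
have u0 : 0 < u by exact: sqr_enormD_gt0.
have T := powRN_taylor _ _ _ (ltW a0) u0 d1.
have KaxE : K a (x - y) = (u + d) `^ (- a).
  by rewrite /K /radial_kernel sqr_enormB /u addrAC.
have KaE : K a y = u `^ (- a) by [].
have Ka1E : K (a + 1) y = u `^ (- a - 1) by rewrite /K /radial_kernel opprD.
rewrite KaxE KaE Ka1E.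
have C00 : 0 <= C0 by rewrite !mulr_ge0 ?powR_ge0 ?(ltW a0)// addr_ge0// ltW.
have T2 : C0 * (d ^+ 2 * u `^ (- a - 2)) <=
    C0 * (2 * m%:R + 1) ^+ 2 * `|x| ^+ 2 * u `^ (- a - 1).
  have -> : - a - 1 = - a - 2 + 1 :> R by ring.
  rewrite (powRD (r := - a - 2)) ?(gt_eqF u0) ?implybT// (powRr1 (ltW u0)).
  have := ler_wpM2l C00 (ler_wpM2r (powR_ge0 u (- a - 2)) d2).
  by move=> /le_trans; apply; rewrite le_eqVlt; apply/orP; left; apply/eqP; ring.
set P := u `^ (- a - 1) in T T2 *.
have P0 : 0 <= P by exact: powR_ge0.
have nx : a * enorm x ^+ 2 * P <= a * m%:R * `|x| ^+ 2 * P.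
  rewrite ler_wpM2r// -mulrA ler_wpM2l ?(ltW a0)//; exact: enorm_le_norm.
rewrite (_ : _ - _ - _ = (u + d) `^ (- a) - u `^ (- a) + a * d * P - a * enorm x ^+ 2 * P);
  last by rewrite /d; ring.
rewrite (le_trans (ler_normB _ _))//.
rewrite [X in _ + X]ger0_norm; last by rewrite !mulr_ge0 ?(ltW a0) ?enorm_ge0.
rewrite /C1 mulrDl mulrDl; apply: lerD; last by [].
exact: le_trans T T2.
Qed.

Let mK b : measurable_fun setT (K b). Proof. exact: measurable_radial_kernel. Qed.

Let measurable_shift (x : 'rV[R]_m) : measurable_fun setT (fun y : 'rV[R]_m => K a (x - y)).
Proof.
apply: (measurableT_comp (mK a)); apply: measurable_fun_rV => i.
under eq_fun do rewrite !mxE.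
by apply: measurable_funB => //; exact: measurable_coord.
Qed.

Let integrable_gM (f : 'rV[R]_m -> R) : L.-integrable setT (EFin \o f) ->
  L.-integrable setT (EFin \o (fun y => f y * g y)).
Proof.
move=> jf; have /measurable_EFinP mf := measurable_int _ jf.
apply: (le_integrable_EFin _ _ _ (fun y => M * `|f y|)) => //.
- exact: measurable_funM.
- by move=> y _; rewrite normrM mulrC ler_wpM2r.
- by have := integrableZl measurableT M (integrable_norm jf).
Qed.

Let iK b : a <= b -> L.-integrable setT (EFin \o K b).
Proof. by move=> ab; exact: integrable_radial_kernel_ge. Qed.

(** For small x, |x - y|^2 + h^2 is at least half of |y|^2 + h^2, which gives the constant 2^a. *)
Let iKx x : `|x| <= e -> L.-integrable setT (EFin \o (fun y => K a (x - y))).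
Proof.
move=> xe.
apply: (le_integrable_EFin _ _ _ (fun y => 2 `^ a * K a y)) => //.
- move=> y _; rewrite ger0_norm ?radial_kernel_ge0//.
  have [d1 _] := shift_bound _ y xe; move: d1; set u := _ + t; set d := _ - _ => d1.
  have u0 : 0 < u by exact: sqr_enormD_gt0.
  have -> : K a (x - y) = (u + d) `^ (- a).
    by rewrite /K /radial_kernel sqr_enormB /u addrAC.
  have ud : u / 2 <= u + d by move: d1; rewrite ler_norml; lra.
  rewrite -[K a y]/(u `^ (- a)) !powRN ler_pdivlMr ?powR_gt0// mulrC.
  rewrite ler_pdivrMr; last by apply: powR_gt0; lra.
  rewrite -powRM//; last by lra.
  by apply: (ge0_ler_powR (ltW a0)); rewrite ?nnegrE; lra.
- by have := integrableZl measurableT (2 `^ a) (iK a (lexx a)).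
Qed.

Let mom i := \int[L]_y (radial_kernel m (m.+1%:R / 2 + 1) (h ^+ 2) y * (g y * y ord0 i)).

Let poisson_integralE x : `|x| <= e ->
  poisson_integral g x h = k * \int[L]_y (K a (x - y) * g y).
Proof.
move=> xe; rewrite /poisson_integral -RintegralZl//; last exact/integrable_gM/iKx.
by apply: eq_Rintegral => y _; rewrite kernelE mulrA.
Qed.

(** [kernel_remainder] is integrated against [g]; its bound depends on x only through |x|^2, so the
    integrated remainder is quadratic. *)
Lemma poisson_gradient : differentiable (poisson_integral g ^~ h) 0 /\
  gradient (poisson_integral g ^~ h) 0 = \row_i (k * (2 * a) * mom i).
Proof.
pose I1 := \int[L]_y K (a + 1) y.
apply: (@gradient_quadratic_remainder _ _ _ _ (k * (M * C1 * I1)) e e0) => x xe.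
have x0 : `|0 : 'rV[R]_m| <= e by rewrite normr0 ltW.
rewrite !poisson_integralE//.
have iKg := integrable_gM _ (iKx _ xe).
have iK0g := integrable_gM _ (iKx _ x0).
have ig i : L.-integrable setT (EFin \o (fun y =>
    radial_kernel m (m.+1%:R / 2 + 1) (h ^+ 2) y * (g y * y ord0 i))).
  exact: (integrable_first_moment m m_gt0 g M i).
pose lin y := 2 * a * dot_rV y x * K (a + 1) y * g y.
have linE : lin = fun y => \sum_(i < m) (2 * a * x ord0 i) *
    (radial_kernel m (m.+1%:R / 2 + 1) (h ^+ 2) y * (g y * y ord0 i)).
  apply/funext => y; rewrite /lin /dot_rV mulr_sumr !mulr_suml.
  by apply: eq_bigr => i _; rewrite -/a -/t -/(K _ _); ring.
have ilin : L.-integrable setT (EFin \o lin).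
  have := @integrable_sum _ _ _ L setT measurableT _ (index_enum 'I_m) predT
    (fun i y => (2 * a * x ord0 i *
      (radial_kernel m (m.+1%:R / 2 + 1) (h ^+ 2) y * (g y * y ord0 i)))%:E).
  rewrite linE (_ : EFin \o _ = fun y => (\sum_(i < m) (2 * a * x ord0 i *
      (radial_kernel m (m.+1%:R / 2 + 1) (h ^+ 2) y *
        (g y * y ord0 i)))%:E)%E); last first.
    by apply/funext => y /=; rewrite -sumEFin.
  by apply => i _; have := integrableZl measurableT (2 * a * x ord0 i) (ig i).
have intlin : \int[L]_y lin y = \sum_(i < m) 2 * a * x ord0 i * mom i.
  rewrite linE /Rintegral.
  under eq_integral do rewrite -sumEFin.
  rewrite integral_sum//; last first.
    by move=> i; have := integrableZl measurableT (2 * a * x ord0 i) (ig i).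
  rewrite -sum_fine; last first.
    move=> i _; apply: (integrable_fin_num measurableT).
    by have := integrableZl measurableT (2 * a * x ord0 i) (ig i).
  apply: eq_bigr => i _; rewrite -[LHS]/(\int[L]_y _) RintegralZl//.
have -> : k * \int[L]_y (K a (x - y) * g y) - k * \int[L]_y (K a (0 - y) * g y) -
    dot_rV (\row_i (k * (2 * a) * mom i)) x =
    k * \int[L]_y (K a (x - y) * g y - K a (0 - y) * g y - lin y).
  rewrite RintegralB//; last by have := integrableB measurableT iKg iK0g.
  rewrite RintegralB// intlin mulrBr mulrBr; congr (_ - _).
  rewrite /dot_rV mulr_sumr; apply: eq_bigr => i _; rewrite mxE; ring.
rewrite normrM (gtr0_norm k0) -[leRHS]mulrA ler_wpM2l ?(ltW k0)//.
have iR : L.-integrable setT (EFin \o (fun y => K a (x - y) * g y - K a (0 - y) * g y - lin y)).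
  by have := integrableB measurableT (integrableB measurableT iKg iK0g) ilin.
have iK1 : L.-integrable setT (EFin \o K (a + 1)) by apply: iK; rewrite lerDl.
apply: le_trans (le_normr_Rintegral measurableT iR) _.
rewrite (_ : M * C1 * I1 * _ = \int[L]_y (M * C1 * `|x| ^+ 2 * K (a + 1) y)); last first.
  by rewrite RintegralZl// /I1; ring.
apply: le_Rintegral => //.
- exact: integrable_norm.
- by have := integrableZl measurableT (M * C1 * `|x| ^+ 2) iK1.
move=> y _.
have -> : K a (0 - y) = K a y.
  by rewrite /K /radial_kernel sub0r -scaleN1r enormZ normrN1 mul1r.
rewrite /lin -mulrBl -mulrBl normrM mulrC.
have -> : M * C1 * `|x| ^+ 2 * K (a + 1) y = M * (C1 * `|x| ^+ 2 * K (a + 1) y) by ring.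
by rewrite ler_pM//; exact: kernel_remainder.
Qed.

Lemma poisson_critical_point : critical_point (poisson_integral g ^~ h) 0 <->
  forall i, \int[L]_y (radial_kernel m (m.+1%:R / 2 + 1) (h ^+ 2) y *
    (g y * y ord0 i)) = 0.
Proof.
have [dP gP] := poisson_gradient; rewrite /critical_point gP; split.
  move=> [_ /rowP c0] i; have := c0 i; rewrite !mxE => /eqP.
  by rewrite mulf_eq0 gt_eqF/= => [/eqP//|]; rewrite mulr_gt0// mulr_gt0.
by move=> c0; split => //; apply/rowP => i; rewrite !mxE /mom c0 mulr0.
Qed.

End poisson_gradient.

(** * The balance law *)

Section borel.
Context {R : realType} (m : nat).

(** The sigma-algebra is generated by the coordinates; an open set is the countable union of the
    cubes it contains among those with rational centre and half side 1/(k + 1). *)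
Lemma open_measurable_rV (A : set 'rV[R]_m) : open A -> measurable A.
Proof.
move=> oA.
pose box (qk : 'rV[rat]_m * nat) : set 'rV[R]_m :=
  (fun y => y - map_mx ratr qk.1) @^-1` cube_rV m qk.2.+1%:R^-1.
have mbox qk : measurable (box qk).
  have msub : measurable_fun setT (fun y : 'rV[R]_m => y - map_mx ratr qk.1).
    apply: measurable_fun_rV => i; under eq_fun do rewrite !mxE.
    by apply: measurable_funB => //; exact: measurable_coord.
  by rewrite -[X in measurable X]setTI; apply: msub => //; exact: measurable_cube_rV.
pose F n := if unpickle n is Some qk then
  (if `[< box qk `<=` A >] then box qk else set0) else set0.
rewrite (_ : A = \bigcup_n F n).
  apply: bigcupT_measurable => n; rewrite /F.
  by case: unpickle => [qk|//]; case: asboolP.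
apply/seteqP; split => [x Ax|x [n _]]; last first.
  by rewrite /F; case: unpickle => [qk|//]; case: asboolP => // sA /sA.
have /nbhs_ballP[e /= e0 xeA] : nbhs x A by exact: open_nbhs_nbhs.
(* Two points of a cube are at sup distance at most 2/(k + 1) < e, so a cube containing x stays in
   the ball. *)
pose k := Num.truncn (2 / e).
have ke : 2 * k.+1%:R^-1 < e.
  by rewrite ltr_pdivrMr// mulrC -ltr_pdivrMr// truncnS_gt.
have k0 : 0 < k.+1%:R^-1 :> R by [].
have /fin_all_exists[q qx] (i : 'I_m) : exists q : rat, `|x ord0 i - ratr q| <= k.+1%:R^-1.
  have : x ord0 i < x ord0 i + k.+1%:R^-1 by rewrite ltrDl.
  move=> /rat_in_itvoo[q]; rewrite in_itv/= => /andP[q1 q2]; exists q.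
  by rewrite ler0_norm ?subr_le0 ?(ltW q1)// opprB lerBlDl ltW.
have xbox : box (\row_i q i, k) x by move=> i; rewrite !mxE.
have boxA : box (\row_i q i, k) `<=` A.
  move=> y yb; apply: xeA; split => // i j; rewrite ord1 /ball/=.
  have := yb j; have := qx j; rewrite !mxE/= => h1 h2.
  apply: le_lt_trans ke; apply: le_trans (ler_distD (ratr (q j)) _ _) _.
  rewrite (distrC (ratr (q j))) mulr_natl mulr2n; exact: lerD.
by exists (pickle (\row_i q i, k)) => //; rewrite /F pickleK; case: asboolP.
Qed.

Lemma continuous_measurable_fun_rV (f : 'rV[R]_m -> R) :
  continuous f -> measurable_fun setT f.
Proof.
move=> /continuousP cf; apply: (measurability _ (RGenOpens.measurableE R)).
move=> _ [_ [a [b ->] <-]]; rewrite setTI; apply: open_measurable_rV.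
exact/cf/interval_open.
Qed.

End borel.

Section balance.
Context {R : realType} (m : nat).
Hypothesis m_gt0 : (0 < m)%N.

Local Notation L := (lebesgue_rV R m).
Local Notation la := (@lebesgue_measure R).

(** The integrand vanishes at v = 0, the only point of this sphere. For m = 1 that point has
    positive mass, because 0^0 = 1. *)
Lemma balance_law0 (f : 'rV[R]_m -> R) : balance_law f 0.
Proof.
apply/rowP => i; rewrite !mxE /Rintegral integral0_eq// => v /= v0.
suff -> : v = 0 by rewrite mxE mulr0.
by apply/eqP; rewrite -enorm_eq0; exact/eqP.
Qed.

Lemma balance_lawP (f g : 'rV[R]_m -> R) (N : set 'rV[R]_m) (r : R) :
  measurable_fun setT g -> measurable N -> (forall x, ~ N x -> f x = g x) ->
  0 < r -> surface_measure m r (N `&` sphere m r) = 0%E ->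
  balance_law f r <->
  forall i, spherical_integral m (fun v => g v * v ord0 i) r = 0.
Proof.
move=> mg mN fg r0 N0.
have mS := @measurable_sphere R m r.
suff E i : \int[surface_measure m r]_(v in sphere m r) (f v * v ord0 i) =
    spherical_integral m (fun v => g v * v ord0 i) r.
  rewrite /balance_law; split => [/rowP b i|b]; first by rewrite -E; have := b i; rewrite !mxE.
  by apply/rowP => i; rewrite !mxE E.
transitivity (\int[surface_measure m r]_(v in sphere m r) (g v * v ord0 i)).
  rewrite Rintegral_mkcond [RHS]Rintegral_mkcond; congr fine.
  apply: (eq_integral_off_null _ (N `&` sphere m r)) => //; first exact: measurableI.
  move=> v Nv /=; rewrite !patchE; case: ifPn => // /set_mem Sv.
  by rewrite fg// => Nv'; apply: Nv.
rewrite /spherical_integral /Rintegral (integral_surface m m_gt0 (fun v => (g v * v ord0 i)%:E))//.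
by apply/measurable_EFinP; apply: measurable_funM => //; exact: measurable_coord.
Qed.

(* A null set has dense complement, so a vanishing radius r_n decreases to r. *)
Lemma spherical_integral_eq0 (f : 'rV[R]_m -> R) (M : R) i (r : R) :
  continuous f -> (forall x, `|f x| <= M) -> 0 < r ->
  {ae la, forall r, 0 < r -> spherical_integral m (fun v => f v * v ord0 i) r = 0} ->
  spherical_integral m (fun v => f v * v ord0 i) r = 0.
Proof.
move=> cf fM r0 [N [mN N0 sN]].
set J := spherical_integral m _.
have M0 : 0 <= M by apply: le_trans (fM 0).
have /choice[rn rnP] (n : nat) : exists s, r < s < r + n.+1%:R^-1 /\ J s = 0.
  apply: contrapT => /forallNP h.
  have : (la `]r, (r + n.+1%:R^-1)%R[ <= la N)%E.
    apply: le_measure; rewrite ?inE// => s /=; rewrite in_itv/= => rs.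
    apply: sN => /= Js; apply: (h s); split => //; apply: Js.
    by case/andP: rs => /(lt_trans r0).
  rewrite [X in (_ <= X)%E]N0 lebesgue_measure_itv/= lte_fin ltrDl.
  by rewrite invr_gt0 ltr0n/= -EFinD addrAC addrN add0r lee_fin leNgt invr_gt0 ltr0n.
have rn_cvg : rn @ \oo --> r.
  apply: (@squeeze_cvgr _ _ _ _ (cst r) (fun n => r + n.+1%:R^-1)).
  - near=> n; have [/andP[/ltW -> /ltW ->] _] := rnP n; by [].
  - exact: cvg_cst.
  - rewrite -[X in _ --> X]addr0; apply: cvgD; first exact: cvg_cst.
    exact: cvg_harmonic.
have rn0 n : 0 < rn n by have [/andP[rr _] _] := rnP n; exact: lt_trans rr.
have rn1 n : rn n <= r + 1.
  have [/andP[_ /ltW rr] _] := rnP n; apply: (le_trans rr).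
  by rewrite lerD2l invf_le1// ler1n.
pose F (s : R) (x : 'rV[R]_m) : R :=
  polar_weight m (s, x) * (f (sphere_proj s x) * (sphere_proj s x) ord0 i).
have mf := continuous_measurable_fun_rV m f cf.
have mF s : measurable_fun setT (F s).
  apply: measurable_funM.
    by apply: (measurableT_comp (@measurable_polar_weight R m)); exact: measurable_pair1.
  apply: measurable_funM; first exact: (measurableT_comp mf (@measurable_sphere_proj R m s)).
  exact: (measurableT_comp (measurable_coord i) (@measurable_sphere_proj R m s)).
(* One bound for all n, since every radius [rn n] is at most r + 1: the first factors bound the
   weight, M (r + 1) bounds f(v) v_i. *)
pose k := m%:R * (r + 1) ^+ m.-1 * (M * (r + 1)).
have F_cvg : {ae L, forall x, setT x -> (EFin \o F (rn n)) x @[n --> \oo] --> (EFin \o F r) x}.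
  apply: aeW => x _; apply: cvg_EFin; first by near=> n.
  rewrite (_ : fine \o _ = fun n => (enorm x <= 1)%R%:R * (m%:R * rn n ^+ m.-1) *
      (f (sphere_proj (rn n) x) * (rn n / enorm x * x ord0 i))); last first.
    by apply/funext => n; rewrite /= /F /polar_weight /= rn0 mul1r mxE.
  rewrite (_ : F r x = (enorm x <= 1)%R%:R * (m%:R * r ^+ m.-1) *
      (f (sphere_proj r x) * (r / enorm x * x ord0 i))); last first.
    by rewrite /F /polar_weight /= r0 mul1r mxE.
  apply: cvgM.
    apply: cvgM; first exact: cvg_cst.
    apply: cvgM; first exact: cvg_cst.
    by apply: (@cvg_comp _ _ _ rn (fun y => y ^+ m.-1) _ (nbhs r)) => //; exact: exprn_continuous.
  apply: cvgM; last first.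
    by apply: cvgM; [apply: cvgM; [exact: rn_cvg|exact: cvg_cst]|exact: cvg_cst].
  apply: (@cvg_comp _ _ _ (fun n => sphere_proj (rn n) x) f _ (nbhs (sphere_proj r x))) => //.
    apply: cvgZr_tmp.
    by apply: cvgM; [exact: rn_cvg|exact: cvg_cst].
  exact: cf.
have F_le x n : `|F (rn n) x| <= k * \1_(@unit_ball R m) x.
  rewrite normrM ger0_norm ?polar_weight_ge0//.
  rewrite /polar_weight/= rn0 mul1r indicE.
  rewrite mem_unit_ball.
  case: (enorm x <= 1); rewrite ?mul0r ?mulr0// mul1r mulr1 /k.
  have rn0' := ltW (rn0 n).
  have r10 : 0 <= r + 1 by rewrite addr_ge0// ltW.
  apply: ler_pM; [by rewrite mulr_ge0// exprn_ge0|exact: normr_ge0| |].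
    by rewrite ler_wpM2l// lerXn2r// nnegrE.
  rewrite normrM ler_pM// (le_trans (coord_le_enorm _ _ _))//.
  have [->|x0] := eqVneq x 0; first by rewrite /sphere_proj scaler0 enorm0.
  by rewrite enorm_sphere_proj.
have F_bound : {ae L, forall x n, setT x ->
    (`|(EFin \o F (rn n)) x| <= (k * \1_(@unit_ball R m) x)%:E)%E}.
  by apply: aeW => x n _; rewrite lee_fin F_le.
have iB : L.-integrable setT (fun x => (k * \1_(@unit_ball R m) x)%:E).
  by have := integrableZl measurableT k (integrable_indic_unit_ball m).
have [_ _] := dominated_convergence measurableT
  (fun n => (measurable_EFinP _ _).2 (mF (rn n)))
  ((measurable_EFinP _ _).2 (mF r)) F_cvg iB F_bound.
have iF n : (\int[L]_x (F (rn n) x)%:E = 0)%E.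
  have [_ Jn] := rnP n; rewrite -[LHS]fineK; first by congr EFin; exact: Jn.
  apply: (integrable_fin_num measurableT).
  apply: (le_integrable_EFin _ _ _ (fun x => k * \1_(@unit_ball R m) x)) => //.
rewrite (_ : [sequence _]_n = cst 0%E); last by apply/funext => n; exact: iF.
move/cvg_lim => /(_ (@ereal_hausdorff R)).
by rewrite [X in X = _ -> _]lim_cst// /J /spherical_integral /Rintegral => <-.
Unshelve. all: by end_near. Qed.

End balance.

(** * Criticality and balance, for almost every and for every radius *)

Section critical_balance.
Context {R : realType} (m : nat).
Hypothesis m_gt0 : (0 < m)%N.

Local Notation la := (@lebesgue_measure R).
Let coord_fun (g : 'rV[R]_m -> R) (i : 'I_m) v := g v * v ord0 i.

(** A Borel function equal to [f] almost everywhere may be unbounded; truncating it at the bound of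
    [f] preserves the equality off [N]. The set [N] is explicit because it has to be sliced by
    spheres. *)
Lemma bounded_measurable_version (f : 'rV[R]_m -> R) :
  lebesgue_measurable_fun f -> bounded_fun f ->
  exists (M : R) (g : 'rV[R]_m -> R) (N : set 'rV[R]_m),
    [/\ measurable_fun setT g, forall x, `|g x| <= M,
    measurable N, lebesgue_rV R m N = 0%E & forall x, ~ N x -> f x = g x].
Proof.
move=> [g mg [N [mN N0 sN]]] /pinfty_ex_gt0[M M0 fM].
exists M, (fun x => Num.max (- M) (Num.min M (g x))), N; split => //.
- by apply: measurable_maxr => //; exact: measurable_minr.
- move=> x; rewrite ler_norml le_max lexx /= ge_max ge_min lexx /=.
  by rewrite lerNl (le_trans _ (ltW M0))// oppr_le0 ltW.
move=> x Nx; have <- : f x = g x.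
  by apply: contrapT => fg; apply: Nx; apply: sN.
have : `|f x| <= M by exact: fM.
rewrite ler_norml => /andP[f1 f2].
by rewrite min_r// max_r.
Qed.

Lemma poisson_integral_off_null (f g : 'rV[R]_m -> R) N :
  measurable N -> lebesgue_rV R m N = 0%E -> (forall x, ~ N x -> f x = g x) ->
  poisson_integral f = poisson_integral g.
Proof.
move=> mN N0 fg; apply/funext => x; apply/funext => h; congr fine.
by apply: (eq_integral_off_null _ N) => // y Ny; rewrite fg.
Qed.

Lemma poisson_critical_spherical (g : 'rV[R]_m -> R) (M : R) :
  measurable_fun setT g -> (forall x, `|g x| <= M) ->
  (forall h : R, 0 < h -> critical_point (poisson_integral g ^~ h) 0) <->
  forall i, {ae la, forall r, 0 < r -> spherical_integral m (coord_fun g i) r = 0}.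
Proof.
move=> mg gM; split => [crit i|sph h h0].
  apply: (ae_eq0_of_moment m m_gt0 g M i mg gM) => t t0.
  have h0 : 0 < Num.sqrt t by rewrite sqrtr_gt0.
  have /(poisson_critical_point m m_gt0 g M mg gM _ h0)/(_ i) := crit _ h0.
  by rewrite sqr_sqrtr// ltW.
apply/(poisson_critical_point m m_gt0 g M mg gM _ h0) => i.
apply: (moment_eq0_of_ae m m_gt0 g M i mg gM (sph i)).
by rewrite exprn_gt0.
Qed.

Lemma poisson_critical_ae_balance (f : 'rV[R]_m -> R) :
  lebesgue_measurable_fun f -> bounded_fun f ->
  (forall h : R, 0 < h -> critical_point (poisson_integral f ^~ h) 0) <->
  {ae la, forall r, 0 <= r -> balance_law f r}.
Proof.
move=> mf bf.
have [M [g [N [mg gM mN N0 fg]]]] := bounded_measurable_version f mf bf.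
rewrite (poisson_integral_off_null _ _ _ mN N0 fg).
have FF := ae_filter_ringOfSetsType la.
have sN := ae_surface_null m m_gt0 N mN N0.
rewrite (poisson_critical_spherical _ _ mg gM); split => [sph|bal].
  (* There are finitely many coordinates, so one null set of radii serves them all. *)
  have {}sph := @filter_forall R 'I_m (fun i => [set r | 0 < r ->
    spherical_integral m (coord_fun g i) r = 0]) _ FF sph.
  apply: filterS2 sN sph => r N0r sph r0.
  have [->|rn0] := eqVneq r 0; first exact: balance_law0.
  have {r0 rn0} r0 : 0 < r by rewrite lt_neqAle eq_sym rn0.
  apply/(balance_lawP m m_gt0 _ _ N _ mg mN fg r0 (N0r r0)) => i.
  exact: sph.
move=> i; apply: filterS2 sN bal => r N0r bal r0.
exact: (balance_lawP m m_gt0 _ _ N _ mg mN fg r0 (N0r r0)).1 (bal (ltW r0)) i.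
Qed.

Lemma ae_balance_continuous (f : 'rV[R]_m -> R) :
  continuous f -> bounded_fun f ->
  {ae la, forall r, 0 <= r -> balance_law f r} -> forall r, 0 <= r -> balance_law f r.
Proof.
move=> cf /pinfty_ex_gt0[M M0 fM] bal r r0.
have {}fM x : `|f x| <= M by exact: fM.
have mf := continuous_measurable_fun_rV m f cf.
(* A continuous [f] is Borel and is its own version, with an empty exceptional set. *)
have balP s (s0 : 0 < s) := balance_lawP m m_gt0 f f set0 s mf measurable0
  (fun _ _ => erefl) s0.
have [->|rn0] := eqVneq r 0; first exact: balance_law0.
have {r0 rn0} r0 : 0 < r by rewrite lt_neqAle eq_sym rn0.
apply/(balP _ r0); first by rewrite set0I measure0.
move=> i; apply: (spherical_integral_eq0 m f M i r cf fM r0).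
have FF := ae_filter_ringOfSetsType la.
apply: filterS bal => s bal s0.
apply: (balP _ s0 _).1; first by rewrite set0I measure0.
exact/bal/ltW.
Qed.

End critical_balance.

(** Changing [f] on a single sphere can break the balance law there without affecting Poisson's
    integral. Hence the first equivalence concerns almost every radius, and continuity gives every
    radius. *)
Theorem theorem3p7 (R : realType) (m : nat) (m_gt0 : (0 < m)%N)
    (f : 'rV[R]_m -> R) (f_meas : lebesgue_measurable_fun f)
    (f_bounded : bounded_fun f) :
  ((forall h : R, 0 < h -> critical_point (poisson_integral f ^~ h) 0) <->
   {ae (@lebesgue_measure R), forall r : R, 0 <= r -> balance_law f r})
  /\
  (continuous f ->
   ((forall h : R, 0 < h -> critical_point (poisson_integral f ^~ h) 0) <->
    (forall r : R, 0 <= r -> balance_law f r))).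
Proof.
have main := poisson_critical_ae_balance m m_gt0 f f_meas f_bounded.
split=> // cf; rewrite main; split.
  exact: ae_balance_continuous.
by move=> bal; exact: aeW.
Qed.
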